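(* Let $\mu=\mu_{q,b}$ with $b>q$ and $\gcd(q,b)=q$. Then given any increasing non-negative function $g$ on $[0,\infty)$, there exists a spectrum $\Lambda$ of $L^2(\mu)$ such that $$\lim_{R\to\infty}\ \sup_{x\in\mathbb{R}}\frac{\#\big(\Lambda\cap(x-R,x+R)\big)}{g(R)}=0.$$
   Context: Let $b>2$ be an integer and let $q<b$ be another positive integer. $\mu_{q,b}$ is the self-similar Borel probability measure $\mu$ on $\mathbb{R}$ satisfying $\mu(E)=\sum_{i=0}^{q-1}\frac1q\,\mu(f_i^{-1}(E))$ for all Borel sets $E$, where $f_i(x)=b^{-1}(x+i)$ for $i=0,1,\dots,q-1$. A countable set $\Lambda\subset\mathbb{R}$ is a spectrum of $L^2(\mu)$ if $\{e^{2\pi i\lambda x}:\lambda\in\Lambda\}$ is an orthonormal basis of $L^2(\mu)$. $\#A$ denotes the cardinality of the set $A$.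
   Formalization: The function g is additionally assumed to tend to infinity; for bounded increasing g the claim is false, since a spectrum is nonempty and the quotient then stays at least 1/sup g. *)

(* Defs.v *)
From mathcomp Require Import all_boot all_order all_algebra.
From mathcomp Require Import complex.
From mathcomp Require Import all_classical all_reals all_analysis.
Set Implicit Arguments.
Unset Strict Implicit.
Unset Printing Implicit Defensive.
Import Order.TTheory GRing.Theory Num.Theory.
Import numFieldNormedType.Exports.

Local Open Scope classical_set_scope.
Local Open Scope ring_scope.
Local Open Scope complex_scope.

Definition ifs_map (R : realType) (b i : nat) (x : R) : R :=
  (b%:R)^-1 * (x + i%:R).

(* Among Borel probability measures this property characterizes mu_{q,b}
   (Hutchinson's existence and uniqueness theorem). *)
Definition self_similar (R : realType) (q b : nat)
    (mu : probability (measurableTypeR R) R) : Prop :=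
  forall E : set (measurableTypeR R), measurable E ->
    mu E = (\sum_(i < q) ((q%:R)^-1)%:E * mu (ifs_map b i @^-1` E))%E.

Section complex_L2.
Context {R : realType}.
Variable mu : probability (measurableTypeR R) R.
Implicit Types f g : measurableTypeR R -> R[i].

Definition cmeasurable f : Prop :=
  measurable_fun setT (fun x => complex.Re (f x)) /\
  measurable_fun setT (fun x => complex.Im (f x)).

Definition L2norm f : \bar R := Lnorm mu 2%:E (fun x => (Normc.normc (f x))%:E).

Definition L2 f : Prop := cmeasurable f /\ (L2norm f < +oo)%E.

Definition cintegral f : R[i] :=
  (\int[mu]_x complex.Re (f x)) +i* (\int[mu]_x complex.Im (f x)).

Definition L2inner f g : R[i] := cintegral (fun x => f x * (g x)^*).

End complex_L2.

(* x |-> e^{2 pi i l x} *)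
Definition cexpo (R : realType) (l : R) (x : measurableTypeR R) : R[i] :=
  cos (2 * pi * l * x) +i* sin (2 * pi * l * x).

(* The exponentials form a family indexed by Lambda: distinct frequencies are
   orthogonal, even if their exponentials agree mu-almost everywhere. *)
Definition orthonormal_exps (R : realType)
    (mu : probability (measurableTypeR R) R) (Lambda : set R) : Prop :=
  forall l l' : R, Lambda l -> Lambda l' ->
    L2inner mu (cexpo l) (cexpo l') = (l == l')%:R.

Definition total_exps (R : realType)
    (mu : probability (measurableTypeR R) R) (Lambda : set R) : Prop :=
  forall f : measurableTypeR R -> R[i], L2 mu f ->
  forall e : R, 0 < e ->
  exists (s : seq R) (c : R -> R[i]),
    (forall l, l \in s -> Lambda l) /\
    (L2norm mu (fun x => f x - \sum_(l <- s) c l * cexpo l x)%R < e%:E)%E.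

Definition spectrum (R : realType)
    (mu : probability (measurableTypeR R) R) (Lambda : set R) : Prop :=
  [/\ countable Lambda, orthonormal_exps mu Lambda & total_exps mu Lambda].

Definition max_count (R : realType) (Lambda : set R) (r : R) : \bar R :=
  ereal_sup [set counting (Lambda `&` `]x - r, x + r[) | x in [set: R]].

(* Main.v *)
Require Import Defs.
From mathcomp Require Import all_boot all_order all_algebra.
From mathcomp Require Import complex.
From mathcomp Require Import all_classical all_reals all_analysis.
From mathcomp Require Import measurable_realfun zify ring lra.
Import Order.TTheory GRing.Theory Num.Theory.
Import numFieldNormedType.Exports.

(** Write [b = q m] with [m >= 2].  The Fourier transform of [mu] is the infinite
    product of the masks [M (t / b ^ j)], [j >= 1], where [M] is the normalised
    exponential sum over the digits [0, ..., q - 1].  It vanishes at [m b ^ j r]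
    whenever [q] does not divide [r], because the factor of index [j + 1] is then
    [M (r / q)], a sum of powers of a nontrivial root of unity.  Hence [m] times
    integers written in base [b] give orthogonal exponentials as soon as, at the first
    place where two of them differ, their digits differ modulo [q].  The
    digits themselves are free modulo [q], and this freedom is what produces sparse
    spectra: the frequency of index [a] has the base-[q] digits [a_j] of [a], and an
    extra digit [q] (congruent to [0]) at a place [N a] beyond all of them; to keep
    the condition on first differences, it also carries the extra digit of each
    truncation [c] of [a] that still agrees with [a] up to the place [N c].
    The digit at [N a] makes the frequency at least
    [b ^ (N a + 1)], so a rapidly growing [N] spreads the frequencies as far apart
    as desired ([freq_gap], [max_count_ratio]).

    Completeness is the real issue, since a sparse orthonormal family need not be
    complete.  It rests on three facts.
    - The [q ^ n] exponentials with [a < q ^ n] are orthogonal as vectors on the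
      [q ^ n] left endpoints of the level-[n] cylinders.  A square matrix with
      orthogonal rows is unitary, so these vectors form a basis and satisfy
      Parseval's identity there ([unitary_parseval]).
    - For a step function [s] of level [n], the coefficient of [s] on such an
      exponential is the discrete coefficient times the conjugate of the Fourier
      transform of [mu] at [freq a / b ^ n].  That value is bounded below uniformly
      in [a] and [n] ([fourier_freq_bound]): the single far digit [q] contributes an
      integer translation by [1] at its own scale, and on [0, b / (b - 1)] the
      integrand of the Fourier transform stays inside an open half-plane
      ([fourier_lower_bound]).  So step functions satisfy a lower frame bound with a
      constant independent of the level ([level_step_frame]).
    - Step functions are dense in [L^2 (mu)] ([level_step_dense]), and Bessel's
      inequality extends the frame bound to all of [L^2].  A lower frame bound makes
      the residuals of the orthogonal projections decrease geometrically
      ([frame_residual_small]), so the exponentials are total. *)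

Set Implicit Arguments.
Unset Strict Implicit.
Unset Printing Implicit Defensive.

Local Open Scope classical_set_scope.
Local Open Scope ring_scope.

Local Notation Re := complex.Re.
Local Notation Im := complex.Im.

(** * Sparse integer frequencies *)

Section Frequencies.
Local Open Scope nat_scope.
Variables (q m : nat) (N : nat -> nat).
Hypotheses (q_gt0 : 0 < q) (m_gt1 : 1 < m) (b_gt2 : 2 < q * m).
Hypothesis N_large : forall a n, a < q ^ n -> a < q ^ N a.
Hypothesis N_mono : {homo N : a b / a < b}.
Local Notation b := (q * m).

(** The extra [q] is the far digit: for [j] beyond all base-[q] digits of [a], the
    residue of [a] modulo [q ^ j.+1] is [a] itself, so it appears at [j = N a].
    Testing the residue instead of [a] makes the [j]-th digit depend only on the
    digits of [a] up to place [j], so two frequencies agree below the first place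
    where the indices differ. *)
Definition freq_digit (a j : nat) : nat :=
  a %/ q ^ j %% q + (if j == N (a %% q ^ j.+1) then q else 0).

Definition freq_partial (n a : nat) : nat := \sum_(j < n) freq_digit a j * b ^ j.

Definition freq (a : nat) : nat := m * freq_partial (N a).+1 a.

Lemma freq_digit_small a j : a < q ^ j -> freq_digit a j = if j == N a then q else 0.
Proof.
move=> aj; rewrite /freq_digit divn_small // mod0n add0n modn_small //.
by rewrite expnS (leq_trans aj) // leq_pmull.
Qed.

(** A far digit is never added to a nonzero digit: [N_large] places it
    beyond the digits of the residue that triggers it. *)
Lemma freq_digit_le a j : freq_digit a j <= q.
Proof.
rewrite /freq_digit; case: eqP => [jE|_]; last by rewrite addn0 ltnW // ltn_mod.
rewrite modn_divl -expnS divn_small // {2}jE.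
by apply: (@N_large _ j.+1); rewrite ltn_mod expn_gt0 q_gt0.
Qed.

(** Digits are at most [q], so [m] times a truncation at level [n] is at most
    [b / (b - 1)] times [b ^ n]. *)
Lemma freq_partial_le n a : b.-1 * freq_partial n a <= q * b ^ n.
Proof.
(* The induction closes only with the extra [q] on the left. *)
suff : b.-1 * freq_partial n a + q <= q * b ^ n by apply: leq_trans; rewrite leq_addr.
have b0 : 0 < b by apply: ltn_trans b_gt2.
elim: n => [|n IH]; first by rewrite /freq_partial big_ord0 muln0 add0n expn0 muln1.
rewrite /freq_partial big_ord_recr /= -/(freq_partial n a) mulnDr.
have h : b.-1 * (freq_digit a n * b ^ n) <= b.-1 * (q * b ^ n).
  by rewrite leq_mul2l leq_mul2r freq_digit_le !orbT.
rewrite expnS -[X in q * (X * _)](prednK b0); move: IH h.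
by move: (b ^ n) (freq_partial n a) (freq_digit a n) (b.-1); clear; nia.
Qed.

Lemma freq_partial_tail k n a : n <= k -> a < q ^ n ->
  freq_partial k a = freq_partial n a + (if n <= N a < k then q * b ^ N a else 0).
Proof.
move=> nk an; rewrite /freq_partial -!(big_mkord xpredT (fun j => freq_digit a j * b ^ j)).
rewrite (@big_cat_nat _ _ _ n) //=; congr addn.
rewrite (eq_big_nat _ _ (F2 := fun j => if j == N a then q * b ^ j else 0)).
  rewrite -big_mkcond /=; case: ifP => NI.
    by rewrite -big_filter filter_pred1_uniq ?iota_uniq ?mem_index_iota // big_seq1.
  by rewrite big_nat_cond big1 // => i /andP[/[swap] /eqP ->]; rewrite NI.
move=> j /andP[nj _]; rewrite freq_digit_small; first by case: ifP.
by rewrite (leq_trans an) // leq_pexp2l.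
Qed.

Lemma freq_partial_ge k a n : a < q ^ n -> N a < k -> freq_partial k a = freq_partial (N a).+1 a.
Proof.
move=> /N_large an Nk; rewrite (freq_partial_tail (ltnW Nk) an) Nk andbT leqnn.
by rewrite (freq_partial_tail (leqnSn _) an) leqnn ltnSn.
Qed.

(** At level [n] a frequency is its truncation, plus at most one digit above:
    the far digit of [a], if that place is not yet reached. *)
Lemma freq_level a n : a < q ^ n ->
  freq a = m * freq_partial n a + (if n <= N a then b ^ (N a).+1 else 0).
Proof.
move=> an; rewrite /freq; case: (leqP n (N a)) => nN.
  rewrite (freq_partial_tail (leqW nN) an) nN ltnSn mulnDr expnS.
  by rewrite mulnA (mulnC m q).
by rewrite (freq_partial_ge an nN) addn0.
Qed.

Lemma freq_bounds a n : a < q ^ n ->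
  b ^ (N a).+1 <= freq a /\ b.-1 * freq a <= b ^ (N a).+2.
Proof.
move=> an; split; last first.
  rewrite /freq mulnCA (leq_trans (leq_mul (leqnn m) (freq_partial_le _ _))) //.
  by rewrite mulnA (mulnC m) -expnS.
rewrite (freq_level (N_large an)) leqnn; exact: leq_addl.
Qed.

(** Frequencies at least double, because the far digit of [a'] lies above all
    digits of [freq a]. *)
Lemma freq_gap a a' n : a < a' -> a' < q ^ n ->
  2 * freq a <= freq a' /\ b ^ (N a').+1 <= freq a'.
Proof.
move=> aa' an; have [h1 h1'] := freq_bounds an.
have [h2 h2'] := freq_bounds (ltn_trans aa' an).
split=> //; rewrite (leq_trans _ h1) // (leq_trans _ (leq_trans h2' _)) //.
  by rewrite leq_mul2r; apply/orP; right; move: b_gt2; case: (b).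
by rewrite leq_pexp2l // ?ltnS ?N_mono // (ltn_trans _ b_gt2).
Qed.

Lemma digit_separation a a' n : a < q ^ n -> a' < q ^ n -> a != a' ->
  exists j, [/\ j < n, a %% q ^ j = a' %% q ^ j &
     a %/ q ^ j %% q != a' %/ q ^ j %% q].
Proof.
elim: n => [|n IH] in a a' *.
  by rewrite expn0 !ltnS !leqn0 => /eqP -> /eqP ->.
move=> an an' aa'.
have [e|e] := eqVneq (a %% q ^ n) (a' %% q ^ n).
  exists n; split=> //.
  rewrite !modn_small ?ltn_divLR ?expn_gt0 ?q_gt0 -?expnS //.
  apply: contra_neq aa' => e'.
  by rewrite (divn_eq a (q ^ n)) (divn_eq a' (q ^ n)) e e'.
have qn0 : 0 < q ^ n by rewrite expn_gt0 q_gt0.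
have [j [jn ej dj]] := IH _ _ (ltn_pmod a qn0) (ltn_pmod a' qn0) e.
have dvd : q ^ j.+1 %| q ^ n by rewrite dvdn_exp2l.
have dvd' : q ^ j %| q ^ n by rewrite dvdn_exp2l // ltnW.
exists j; split; first exact: ltnW.
  by move: ej; rewrite !(modn_dvdm _ dvd').
by move: dj; rewrite !modn_divl -!expnS !(modn_dvdm _ dvd).
Qed.

Lemma freq_partial_split k j a : j < k ->
  exists X, freq_partial k a = freq_partial j a + b ^ j * (freq_digit a j + b * X).
Proof.
move=> jk; rewrite /freq_partial -!(big_mkord xpredT (fun j => freq_digit a j * b ^ j)).
rewrite (@big_cat_nat _ _ _ j) //=; last exact: ltnW.
rewrite (big_ltn jk).
exists (\sum_(j.+1 <= i < k) freq_digit a i * b ^ (i - j.+1)).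
congr addn; rewrite mulnDr mulnC; congr addn.
rewrite mulnA -expnSr big_distrr /=; apply: eq_big_nat => i /andP[ji _].
by rewrite mulnCA -expnD subnKC.
Qed.

(** The shape needed to hit a zero of the mask: after division by [b ^ j.+1], the
    difference of the two frequencies is [(Y - Y') / q]. *)
Lemma freq_separation a a' n : a < q ^ n -> a' < q ^ n -> a != a' ->
  exists j T Y Y', [/\ j < n, freq a = m * (T + b ^ j * Y),
    freq a' = m * (T + b ^ j * Y') & Y %% q != Y' %% q].
Proof.
move=> an an' aa'; have [j [jn ej dj]] := digit_separation an an' aa'.
(* Beyond [N a] the partial sums of [a] are constant, so both frequencies can
   be read at the same length. *)
pose k := maxn j.+1 (maxn (N a).+1 (N a').+1).
have jk : j < k by rewrite /k leq_max leqnn.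
have [X eX] := freq_partial_split a jk; have [X' eX'] := freq_partial_split a' jk.
exists j, (freq_partial j a), (freq_digit a j + b * X), (freq_digit a' j + b * X').
split=> //.
- by rewrite -eX (freq_partial_ge an) // /k !leq_max leqnn !orbT.
- have -> : freq_partial j a = freq_partial j a'.
    apply: eq_bigr => i _; congr muln.
    have dvd : q ^ i.+1 %| q ^ j by rewrite dvdn_exp2l.
    by rewrite /freq_digit !modn_divl -expnS -(modn_dvdm a dvd) -(modn_dvdm a' dvd) ej.
  by rewrite -eX' (freq_partial_ge an') // /k !leq_max leqnn !orbT.
- have fdm i c Z : (freq_digit c i + b * Z) %% q = c %/ q ^ i %% q.
    rewrite /freq_digit -mulnA addnC mulnC modnMDl -modnDmr.
    by case: ifP => _; rewrite ?modnn ?mod0n addn0 ?modn_mod.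
  by rewrite !fdm.
Qed.

End Frequencies.

(** * Unimodular exponentials *)

Section Expi.
Variable R : realType.
Implicit Types s t : R.
Local Open Scope complex_scope.

Definition expi t : R[i] := cos t +i* sin t.

Lemma cexpoE (l : R) (x : measurableTypeR R) : cexpo l x = expi (2 * pi * l * x).
Proof. by []. Qed.

Lemma expi0 : expi 0 = 1.
Proof. by rewrite /expi cos0 sin0. Qed.

Lemma expiD s t : expi (s + t) = expi s * expi t.
Proof. by rewrite /expi cosD sinD /GRing.mul /= addrC [X in _ +i* X]addrC. Qed.

Lemma conj_expi t : ((expi t)^*)%R = expi (- t).
Proof. by rewrite /expi cosN sinN. Qed.

Lemma expi_neq0 t : expi t != 0.
Proof.
apply/eqP => e; have := expiD t (- t); rewrite subrr expi0 e mul0r => /eqP.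
by rewrite oner_eq0.
Qed.

Lemma expiMn n t : expi (n%:R * t) = expi t ^+ n.
Proof.
elim: n => [|n IH]; first by rewrite mul0r expi0 expr0.
by rewrite -natr1 mulrDl mul1r expiD IH exprSr.
Qed.

Lemma expi_nat n : expi (2 * pi * n%:R) = 1.
Proof.
rewrite mulrC expiMn mulrC mulr_natr (_ : expi _ = 1) ?expr1n //.
by rewrite /expi cos2pi sin2pi.
Qed.

Lemma expi_neq1 t : 0 < t < 2 * pi -> expi t != 1.
Proof.
move=> /andP[t0 t2]; apply/eqP => -[c1 _].
have : 0 < sin (t / 2) by apply: sin_gt0_pi; lra.
have : cos t = 1 - 2 * sin (t / 2) ^+ 2.
  have := cosD (t / 2) (t / 2); have := cos2Dsin2 (t / 2).
  rewrite -splitr; lra.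
rewrite c1; nra.
Qed.

(** The summands are the powers of a [q]-th root of unity different from [1]. *)
Lemma expi_root_sum (q Y Y' : nat) : (0 < q)%N -> (Y %% q != Y' %% q)%N ->
  \sum_(i < q) expi (2 * pi * ((Y%:R - Y'%:R) / q%:R) * i%:R) = 0.
Proof.
move=> q0 YY'.
have q0' : (q%:R : R) != 0 by rewrite pnatr_eq0 -lt0n.
pose z := expi (2 * pi * ((Y%:R - Y'%:R) / q%:R)).
have -> : \sum_(i < q) expi (2 * pi * ((Y%:R - Y'%:R) / q%:R) * i%:R) =
          \sum_(i < q) z ^+ i.
  by apply: eq_bigr => i _; rewrite mulrC expiMn.
have hz (Z : nat) : expi (2 * pi * (Z%:R / q%:R)) =
                    expi (2 * pi * ((Z %% q)%N%:R / q%:R)).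
  rewrite {1}(divn_eq Z q) natrD natrM.
  have -> : 2 * pi * (((Z %/ q)%:R * q%:R + (Z %% q)%:R) / q%:R) =
    2 * pi * (Z %/ q)%:R + 2 * pi * ((Z %% q)%:R / q%:R) :> R by field.
  by rewrite expiD expi_nat mul1r.
have zE : z * expi (2 * pi * (Y'%:R / q%:R)) = expi (2 * pi * (Y%:R / q%:R)).
  by rewrite /z -expiD; congr expi; field.
have zq : z ^+ q = 1.
  have -> : z ^+ q = expi (2 * pi * Y%:R - 2 * pi * Y'%:R).
    by rewrite /z -expiMn; congr expi; field.
  apply: (mulIf (expi_neq0 (2 * pi * Y'%:R))).
  by rewrite -expiD subrK mul1r !expi_nat.
have lt_case (r r' : nat) : (r' < r)%N -> (r < q)%N ->
    expi (2 * pi * (r%:R / q%:R)) <> expi (2 * pi * (r'%:R / q%:R)).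
  move=> r'r rq e; have /negP[] : expi (2 * pi * ((r - r')%:R / q%:R)) != 1.
    apply: expi_neq1; have p0 := pi_gt0 R; apply/andP; split.
      by rewrite !mulr_gt0 // ?invr_gt0 ltr0n ?subn_gt0.
    rewrite -[X in _ < X]mulr1 ltr_pM2l ?mulr_gt0 //.
    rewrite ltr_pdivrMr ?ltr0n // mul1r ltr_nat.
    by apply: leq_ltn_trans rq; exact: leq_subr.
  apply/eqP; apply: (mulIf (expi_neq0 (2 * pi * (r'%:R / q%:R)))).
  rewrite -expiD mul1r -e; congr expi; rewrite natrB 1?ltnW //; by field.
have z1 : z != 1.
  apply/eqP => z1; move: zE; rewrite z1 mul1r hz [in RHS]hz.
  case: (ltngtP (Y %% q)%N (Y' %% q)%N) YY' => [h _|h _|//].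
    by apply: lt_case => //; rewrite ltn_mod.
  by move/esym; apply: lt_case => //; rewrite ltn_mod.
have /eqP := subrX1 z q; rewrite zq subrr eq_sym mulf_eq0 subr_eq0 (negbTE z1).
by move/eqP.
Qed.

End Expi.

(** * Bounded and square-integrable real functions *)

Section Integration.
Context {R : realType}.
Variable mu : probability (measurableTypeR R) R.
Local Notation T := (measurableTypeR R).
Implicit Types (u v : T -> R) (f g : T -> R[i]).
Local Open Scope complex_scope.

Definition bounded_mfun u : Prop :=
  measurable_fun setT u /\ exists M : R, forall x, `|u x| <= M.

Definition square_integrable u : Prop :=
  measurable_fun setT u /\ mu.-integrable setT (EFin \o (fun x => u x ^+ 2)).

Lemma bounded_mfun_integrable u : bounded_mfun u -> mu.-integrable setT (EFin \o u).
Proof.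
move=> [mu_ [M uM]]; apply: measurable_bounded_integrable => //.
  by rewrite (le_lt_trans (probability_le1 mu measurableT)) // ltry.
exists M; split; first exact: num_real.
by move=> r Mr x _; apply: le_trans (uM x) (ltW Mr).
Qed.

Lemma bounded_mfunD u v : bounded_mfun u -> bounded_mfun v ->
  bounded_mfun (fun x => u x + v x).
Proof.
move=> [mu_ [M uM]] [mv [K vK]]; split; first exact: measurable_funD.
by exists (M + K) => x; rewrite (le_trans (ler_normD _ _)) // lerD.
Qed.

Lemma bounded_mfunM u v : bounded_mfun u -> bounded_mfun v ->
  bounded_mfun (fun x => u x * v x).
Proof.
move=> [mu_ [M uM]] [mv [K vK]]; split; first exact: measurable_funM.
by exists (M * K) => x; rewrite normrM ler_pM.
Qed.

Lemma bounded_mfun_cst (a : R) : bounded_mfun (fun=> a).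
Proof. by split=> //; exists `|a|. Qed.

Lemma bounded_mfunN u : bounded_mfun u -> bounded_mfun (fun x => - u x).
Proof.
move=> bu; have -> : (fun x => - u x) = (fun x => -1 * u x).
  by apply/funext => x; rewrite mulN1r.
exact: bounded_mfunM (bounded_mfun_cst _) bu.
Qed.

Lemma bounded_mfun_comp u (h : T -> T) : measurable_fun setT h ->
  bounded_mfun u -> bounded_mfun (fun x => u (h x)).
Proof.
move=> mh [mu_ [M uM]]; split; first exact: measurableT_comp.
by exists M.
Qed.

Lemma square_integrable_mul u v : square_integrable u -> square_integrable v ->
  mu.-integrable setT (EFin \o (fun x => u x * v x)).
Proof.
move=> [mu_ iu] [mv iv].
apply: (@le_integrable _ _ _ _ _ measurableT _
  (EFin \o (fun x => u x ^+ 2 + v x ^+ 2))).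
- by apply/measurable_EFinP; exact: measurable_funM.
- move=> x _ /=; rewrite lee_fin.
  rewrite [leRHS]ger0_norm ?addr_ge0 ?sqr_ge0 // ler_norml.
  have := sqr_ge0 (u x + v x); have := sqr_ge0 (u x - v x).
  have := sqr_ge0 (u x); have := sqr_ge0 (v x).
  by move=> *; apply/andP; split; nra.
- by rewrite (_ : _ \o _ = (EFin \o (fun x => u x ^+ 2)) \+
    (EFin \o (fun x => v x ^+ 2))) //; exact: integrableD.
Qed.

Lemma square_integrableD u v : square_integrable u -> square_integrable v ->
  square_integrable (fun x => u x + v x).
Proof.
move=> su sv; split; first by apply: measurable_funD; [case: su|case: sv].
have -> : EFin \o (fun x => (u x + v x) ^+ 2) =
   (EFin \o (fun x => u x ^+ 2)) \+ ((EFin \o (fun x => u x * v x)) \+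
   ((EFin \o (fun x => u x * v x)) \+ (EFin \o (fun x => v x ^+ 2)))).
  by apply/funext => x /=; rewrite -!EFinD; congr EFin; ring.
have h := square_integrable_mul su sv.
apply: integrableD => //; first by case: su.
apply: integrableD => //; apply: integrableD => //; by case: sv.
Qed.

Lemma square_integrableM u v : bounded_mfun u -> square_integrable v ->
  square_integrable (fun x => u x * v x).
Proof.
move=> [mu_ [M uM]] [mv iv]; have mm := measurable_funM mu_ mv; split=> //.
apply: (@le_integrable _ _ _ _ _ measurableT _
   (EFin \o (fun x => M ^+ 2 * v x ^+ 2))).
- apply/measurable_EFinP; exact: (measurable_funX 2%N mm).
- move=> x _ /=; rewrite lee_fin [leLHS]ger0_norm ?sqr_ge0 //.
  rewrite [leRHS]ger0_norm; last by apply: mulr_ge0; exact: sqr_ge0.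
  rewrite exprMn.
  apply: ler_wpM2r; first exact: sqr_ge0.
  by rewrite -real_normK ?num_real // lerXn2r ?nnegrE // (le_trans _ (uM x)).
- exact: (integrableZl measurableT (M ^+ 2) iv).
Qed.

Lemma bounded_square_integrable u : bounded_mfun u -> square_integrable u.
Proof.
move=> bu; split; first by case: bu.
by apply: bounded_mfun_integrable; apply: (bounded_mfunM bu bu).
Qed.

End Integration.

(** * Complex-valued integrals *)

Section ComplexParts.
Variable R : realType.
Local Open Scope complex_scope.
Implicit Types z w : R[i].

Lemma Re_add z w : Re (z + w) = Re z + Re w. Proof. by case: z w => ? ? []. Qed.
Lemma Im_add z w : Im (z + w) = Im z + Im w. Proof. by case: z w => ? ? []. Qed.
Lemma Re_mul z w : Re (z * w) = Re z * Re w - Im z * Im w.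
Proof. by case: z w => ? ? []. Qed.
Lemma Im_mul z w : Im (z * w) = Re z * Im w + Im z * Re w.
Proof. by case: z w => ? ? []. Qed.
Lemma Re_conj z : Re (z^*)%R = Re z. Proof. by case: z. Qed.
Lemma Im_conj z : Im (z^*)%R = - Im z. Proof. by case: z. Qed.

Lemma complex_eqP z w : Re z = Re w -> Im z = Im w -> z = w.
Proof. by case: z w => ? ? [? ?] /= -> ->. Qed.

Definition sqnormc z : R := Re z ^+ 2 + Im z ^+ 2.

Lemma sqnormc_ge0 z : 0 <= sqnormc z.
Proof. by rewrite addr_ge0 ?sqr_ge0. Qed.

Lemma mul_conjc_sqnormc z : z * (z^*)%R = (sqnormc z)%:C.
Proof.
by apply: complex_eqP; rewrite ?Re_mul ?Im_mul Re_conj Im_conj /sqnormc /=; ring.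
Qed.

Lemma sqnormcM z w : sqnormc (z * w) = sqnormc z * sqnormc w.
Proof. by rewrite /sqnormc Re_mul Im_mul; ring. Qed.

Lemma sqnormc_conj z : sqnormc (z^*)%R = sqnormc z.
Proof. by rewrite /sqnormc Re_conj Im_conj sqrrN. Qed.

Lemma sqnormcD_le z w : sqnormc (z + w) <= 2 * sqnormc z + 2 * sqnormc w.
Proof.
rewrite /sqnormc Re_add Im_add.
have := sqr_ge0 (Re z - Re w); have := sqr_ge0 (Im z - Im w); nra.
Qed.

Lemma sqnormc_expi t : sqnormc (expi t) = 1 :> R.
Proof. exact: cos2Dsin2. Qed.

Lemma sqr_normc_sqnormc z : Normc.normc z ^+ 2 = sqnormc z.
Proof. by case: z => a c /=; rewrite sqr_sqrtr // addr_ge0 ?sqr_ge0. Qed.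

End ComplexParts.

Section ComplexIntegral.
Context {R : realType}.
Variable mu : probability (measurableTypeR R) R.
Local Notation T := (measurableTypeR R).
Implicit Types (u v : T -> R) (f g h : T -> R[i]) (c : R[i]).
Local Open Scope complex_scope.

Definition cintegrable f : Prop :=
  mu.-integrable setT (EFin \o (fun x => Re (f x))) /\
  mu.-integrable setT (EFin \o (fun x => Im (f x))).

Definition csquare_integrable f : Prop :=
  square_integrable mu (fun x => Re (f x)) /\
  square_integrable mu (fun x => Im (f x)).

Definition cbounded f : Prop :=
  bounded_mfun (fun x => Re (f x)) /\ bounded_mfun (fun x => Im (f x)).

Lemma cintegralD f g : cintegrable f -> cintegrable g ->
  cintegral mu (fun x => f x + g x) = cintegral mu f + cintegral mu g.
Proof.
move=> [fr fi] [gr gi]; apply: complex_eqP; rewrite ?Re_add ?Im_add /=.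
  by under eq_Rintegral do rewrite Re_add; rewrite RintegralD.
by under eq_Rintegral do rewrite Im_add; rewrite RintegralD.
Qed.

Lemma cintegralZ c f : cintegrable f ->
  cintegral mu (fun x => c * f x) = c * cintegral mu f.
Proof.
move=> [fr fi]; have zr (a : R) u : mu.-integrable setT (EFin \o u) ->
    mu.-integrable setT (EFin \o (fun x => a * u x)).
  by move=> iu; exact: (integrableZl measurableT a iu).
apply: complex_eqP; rewrite ?Re_mul ?Im_mul /cintegral /=.
  under eq_Rintegral do rewrite Re_mul.
  rewrite RintegralB //; [|exact: zr|exact: zr].
  by rewrite !RintegralZl.
under eq_Rintegral do rewrite Im_mul.
rewrite RintegralD //; [|exact: zr|exact: zr].
by rewrite !RintegralZl.
Qed.

Lemma cintegral_conj f : cintegrable f ->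
  cintegral mu (fun x => (f x)^*)%R = ((cintegral mu f)^*)%R.
Proof.
move=> [fr fi]; apply: complex_eqP; rewrite ?Re_conj ?Im_conj /cintegral /=.
  by under eq_Rintegral do rewrite Re_conj.
under eq_Rintegral do rewrite Im_conj -mulN1r.
by rewrite RintegralZl // mulN1r.
Qed.

Lemma cbounded_square_integrable f : cbounded f -> csquare_integrable f.
Proof. by case=> *; split; exact: bounded_square_integrable. Qed.

Lemma cbounded_integrable f : cbounded f -> cintegrable f.
Proof. by case=> *; split; exact: bounded_mfun_integrable. Qed.

Lemma cbounded_cst c : cbounded (fun=> c).
Proof. by split; exact: bounded_mfun_cst. Qed.

Lemma cboundedM f g : cbounded f -> cbounded g -> cbounded (fun x => f x * g x).
Proof.
move=> [fr fi] [gr gi]; split.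
  under eq_fun do rewrite Re_mul.
  apply: bounded_mfunD; first exact: bounded_mfunM.
  by apply: bounded_mfunN; exact: bounded_mfunM.
by under eq_fun do rewrite Im_mul; apply: bounded_mfunD; exact: bounded_mfunM.
Qed.

Lemma cbounded_conj f : cbounded f -> cbounded (fun x => (f x)^*)%R.
Proof.
move=> [fr fi]; split; first by under eq_fun do rewrite Re_conj.
by under eq_fun do rewrite Im_conj; exact: bounded_mfunN.
Qed.

Lemma cbounded_comp f (k : T -> T) : measurable_fun setT k ->
  cbounded f -> cbounded (fun x => f (k x)).
Proof.
move=> mk [fr fi].
by split; [exact: (bounded_mfun_comp mk fr)|exact: (bounded_mfun_comp mk fi)].
Qed.

Lemma cbounded_cexpo (l : R) : cbounded (@cexpo R l).
Proof.
have m : measurable_fun setT (fun x : T => 2 * pi * l * x).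
  exact: measurable_funM.
split; split.
- apply: (@measurableT_comp _ _ _ _ _ _ (@cos R)) m.
  apply: continuous_measurable_fun; exact: continuous_cos.
- by exists 1 => x; rewrite ler_norml cos_geN1 cos_le1.
- apply: (@measurableT_comp _ _ _ _ _ _ (@sin R)) m.
  apply: continuous_measurable_fun; exact: continuous_sin.
- by exists 1 => x; rewrite ler_norml sin_geN1 sin_le1.
Qed.

Lemma csquare_integrableD f g : csquare_integrable f -> csquare_integrable g ->
  csquare_integrable (fun x => f x + g x).
Proof.
move=> [fr fi] [gr gi]; split.
  by under eq_fun do rewrite Re_add; exact: square_integrableD.
by under eq_fun do rewrite Im_add; exact: square_integrableD.
Qed.

Lemma csquare_integrableZ c f : csquare_integrable f ->
  csquare_integrable (fun x => c * f x).
Proof.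
move=> [fr fi].
have z (a : R) u : square_integrable mu u -> square_integrable mu (fun x => a * u x).
  exact: (square_integrableM (bounded_mfun_cst a)).
split; [under eq_fun do rewrite Re_mul -mulNr|under eq_fun do rewrite Im_mul];
  by apply: square_integrableD; exact: z.
Qed.

Lemma csquare_integrable_sum (I : Type) (s : seq I) (F : I -> T -> R[i]) :
  (forall i, csquare_integrable (F i)) ->
  csquare_integrable (fun x => \sum_(i <- s) F i x).
Proof.
move=> hF; elim: s => [|i s IH].
  by under eq_fun do rewrite big_nil; apply/cbounded_square_integrable/cbounded_cst.
by under eq_fun do rewrite big_cons; exact: csquare_integrableD.
Qed.

Lemma csquare_integrable_mul f g : csquare_integrable f -> csquare_integrable g ->
  cintegrable (fun x => f x * (g x)^*)%R.
Proof.
move=> [fr fi] [gr gi]; have m := square_integrable_mul; split.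
  rewrite (_ : _ \o _ = (EFin \o (fun x => Re (f x) * Re (g x))) \+
      (EFin \o (fun x => Im (f x) * Im (g x)))).
    by apply: integrableD => //; exact: m.
  apply/funext => x /=; rewrite Re_mul Re_conj Im_conj -EFinD; congr EFin; ring.
rewrite (_ : _ \o _ = ((EFin \o (fun x => Im (f x) * Re (g x))%R) \-
    (EFin \o (fun x => Re (f x) * Im (g x))%R))%E).
  by apply: integrableB => //; exact: m.
apply/funext => x /=; rewrite Im_mul Re_conj Im_conj -EFinB; congr EFin; ring.
Qed.

End ComplexIntegral.

(** * Orthonormal families and lower frame bounds *)

Section InnerProduct.
Context {R : realType}.
Variable mu : probability (measurableTypeR R) R.
Local Notation T := (measurableTypeR R).
Implicit Types (f g h u s : T -> R[i]) (c : R[i]).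
Local Notation sqint := (csquare_integrable mu).
Local Notation inner := (L2inner mu).
Local Open Scope complex_scope.

Definition sqnorm f : R := \int[mu]_x sqnormc (f x).

Lemma sqnorm_ge0 f : 0 <= sqnorm f.
Proof. by apply: Rintegral_ge0 => x _; exact: sqnormc_ge0. Qed.

Lemma innerDl f g h : sqint f -> sqint g -> sqint h ->
  inner (fun x => f x + g x) h = inner f h + inner g h.
Proof.
move=> sf sg sh; rewrite /L2inner -cintegralD; try exact: csquare_integrable_mul.
by congr cintegral; apply/funext => x; rewrite mulrDl.
Qed.

Lemma innerZl c f h : sqint f -> sqint h ->
  inner (fun x => c * f x) h = c * inner f h.
Proof.
move=> sf sh; rewrite /L2inner -cintegralZ; last exact: csquare_integrable_mul.
by congr cintegral; apply/funext => x; rewrite mulrA.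
Qed.

Lemma inner_conj f g : sqint f -> sqint g -> inner g f = ((inner f g)^*)%R.
Proof.
move=> sf sg; rewrite /L2inner -cintegral_conj; last exact: csquare_integrable_mul.
by congr cintegral; apply/funext => x; rewrite rmorphM /= conjCK mulrC.
Qed.

Lemma inner_suml (I : Type) (r : seq I) (F : I -> T -> R[i]) h :
  (forall i, sqint (F i)) -> sqint h ->
  inner (fun x => \sum_(i <- r) F i x) h = \sum_(i <- r) inner (F i) h.
Proof.
move=> sF sh; elim: r => [|i r IH].
  rewrite big_nil -[RHS](mul0r (inner h h)) -innerZl //; congr (inner _ h).
  by apply/funext => x; rewrite big_nil mul0r.
rewrite big_cons -IH -innerDl //; last exact: csquare_integrable_sum.
by congr (inner _ h); apply/funext => x; rewrite big_cons.
Qed.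

Lemma inner_sqnorm f : inner f f = (sqnorm f)%:C.
Proof.
rewrite /L2inner /cintegral /sqnorm; apply: complex_eqP => /=.
  by apply: eq_Rintegral => x _; rewrite mul_conjc_sqnormc.
under eq_Rintegral do rewrite mul_conjc_sqnormc /=.
by rewrite Rintegral_cst // mul0r.
Qed.

Lemma sqnormc_integrable f : sqint f ->
  mu.-integrable setT (EFin \o (fun x => sqnormc (f x))).
Proof.
move=> [[_ fr] [_ fi]].
by rewrite (_ : _ \o _ = (EFin \o (fun x => Re (f x) ^+ 2)) \+
  (EFin \o (fun x => Im (f x) ^+ 2))) //; exact: integrableD.
Qed.

Lemma sqnormD_le f g : sqint f -> sqint g ->
  sqnorm (fun x => f x + g x) <= 2 * sqnorm f + 2 * sqnorm g.
Proof.
move=> sf sg; have sfg := csquare_integrableD sf sg.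
have iz u (r : R) : sqint u -> mu.-integrable setT (EFin \o (fun x => r * sqnormc (u x))).
  by move=> su; exact: (integrableZl measurableT r (sqnormc_integrable su)).
rewrite /sqnorm -!RintegralZl; try exact: sqnormc_integrable.
- rewrite -RintegralD //; try exact: iz.
  apply: le_Rintegral => //; first exact: sqnormc_integrable.
    rewrite (_ : _ \o _ = (EFin \o (fun x => 2 * sqnormc (f x))) \+
      (EFin \o (fun x => 2 * sqnormc (g x)))) //.
    by apply: integrableD => //; exact: iz.
  by move=> x _; exact: sqnormcD_le.
- exact: measurableT.
- exact: measurableT.
Qed.

Section Projection.
Variables (e : nat -> T -> R[i]) (K : nat).
Hypothesis sqe : forall a, sqint (e a).
Hypothesis one : forall a a', (a < K)%N -> (a' < K)%N ->
  inner (e a) (e a') = (a == a')%:R.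

Definition residual u x := u x - \sum_(a < K) inner u (e a) * e a x.

Lemma residual_square_integrable u : sqint u -> sqint (residual u).
Proof.
move=> su; rewrite /residual; apply: csquare_integrableD => //.
under eq_fun do rewrite -mulN1r; apply: csquare_integrableZ.
by apply: csquare_integrable_sum => i; exact: csquare_integrableZ.
Qed.

Lemma inner_residual u v : sqint u -> sqint v ->
  inner (residual u) v = inner u v - \sum_(a < K) inner u (e a) * inner (e a) v.
Proof.
move=> su sv; have sz a : sqint (fun x => inner u (e a) * e a x).
  exact: csquare_integrableZ.
pose S x := \sum_(a < K) inner u (e a) * e a x.
have sS : sqint S by exact: csquare_integrable_sum.
have -> : residual u = (fun x => u x + -1 * S x).
  by apply/funext => x; rewrite mulN1r.
rewrite innerDl //; last exact: csquare_integrableZ.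
rewrite innerZl // mulN1r inner_suml //; congr (_ - _).
by apply: eq_bigr => a _; rewrite innerZl.
Qed.

Lemma inner_residual_in u a : sqint u -> (a < K)%N -> inner (residual u) (e a) = 0.
Proof.
move=> su aK; rewrite inner_residual // (bigD1 (Ordinal aK)) //= one // eqxx mulr1.
rewrite big1 ?addr0 ?subrr // => i ia; rewrite one // (_ : _ == _ = false) ?mulr0 //.
by apply/negbTE; apply: contra ia => /eqP ia; apply/eqP/val_inj.
Qed.

Lemma sqnorm_residual u : sqint u ->
  sqnorm (residual u) = sqnorm u - \sum_(a < K) sqnormc (inner u (e a)).
Proof.
move=> su; have sr := residual_square_integrable su.
apply: complexI; rewrite -inner_sqnorm inner_residual //.
rewrite big1 ?subr0; last first.
  move=> a _; rewrite (inner_conj sr) // inner_residual_in //.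
  by rewrite rmorph0 mulr0.
rewrite (inner_conj sr) // inner_residual // rmorphB /= rmorph_sum /=.
rewrite inner_sqnorm rmorphB rmorph_sum /=; congr (_ - _); first exact: conjc_real.
by apply: eq_bigr => a _; rewrite rmorphM (inner_conj su) //= conjCK mulrC mul_conjc_sqnormc.
Qed.

Lemma bessel u : sqint u -> \sum_(a < K) sqnormc (inner u (e a)) <= sqnorm u.
Proof.
by move=> su; rewrite -subr_ge0 -sqnorm_residual // sqnorm_ge0.
Qed.

(** Bessel's inequality makes the frame functional continuous, so a lower frame
    bound at a nearby function [s] transfers to [u]. *)
Lemma frame_bound_nearby u s (k : R) : 0 <= k <= 1 -> sqint u -> sqint s ->
  k * sqnorm s <= \sum_(a < K) sqnormc (inner s (e a)) ->
  k / 4 * sqnorm u - 2 * sqnorm (fun x => u x - s x) <=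
    \sum_(a < K) sqnormc (inner u (e a)).
Proof.
move=> /andP[k0 k1] su ss hs; set d := sqnorm (fun x => u x - s x).
have sNd : sqint (fun x => s x - u x).
  apply: csquare_integrableD => //.
  by under eq_fun do rewrite -mulN1r; exact: csquare_integrableZ.
have dE : sqnorm (fun x => s x - u x) = d.
  apply: eq_Rintegral => x _; rewrite -opprB /sqnormc.
  by rewrite -mulN1r Re_mul Im_mul /=; ring.
have su_le : sqnorm u <= 2 * sqnorm s + 2 * d.
  have sd : sqint (fun x => u x - s x).
    apply: csquare_integrableD => //.
    by under eq_fun do rewrite -mulN1r; exact: csquare_integrableZ.
  apply: le_trans (sqnormD_le ss sd); rewrite le_eqVlt; apply/orP; left; apply/eqP.
  by apply: eq_Rintegral => x _; rewrite addrC subrK.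
have le1 : \sum_(a < K) sqnormc (inner s (e a)) <=
    2 * \sum_(a < K) sqnormc (inner u (e a)) + 2 * d.
  apply: (@le_trans _ _ (2 * \sum_(a < K) sqnormc (inner u (e a)) +
    2 * \sum_(a < K) sqnormc (inner (fun x => s x - u x) (e a)))); last first.
    by rewrite lerD2l ler_pM2l // -dE bessel.
  rewrite !mulr_sumr -big_split /=; apply: ler_sum => a _.
  rewrite (_ : inner s (e a) = inner u (e a) + inner (fun x => s x - u x) (e a)).
    exact: sqnormcD_le.
  rewrite -innerDl //; congr (inner _ _); apply/funext => x.
  by rewrite addrC subrK.
have d0 : 0 <= d by exact: sqnorm_ge0.
have kd : 0 <= (1 - k) * d by rewrite mulr_ge0 // subr_ge0.
have ku : 0 <= k * (2 * sqnorm s + 2 * d - sqnorm u).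
  by rewrite mulr_ge0 // subr_ge0.
lra.
Qed.

End Projection.

(** A lower frame bound forces completeness: the part of a residual that a
    larger family sees is a fixed proportion of it, so the residuals on growing
    finite families shrink geometrically. *)
Lemma frame_residual_small (e : nat -> T -> R[i]) (K : nat -> nat) (k : R) :
  (forall a, sqint (e a)) -> {homo K : n n' / (n <= n')%N} ->
  (forall n a a', (a < K n)%N -> (a' < K n)%N ->
    inner (e a) (e a') = (a == a')%:R) ->
  0 < k <= 1 ->
  (forall u, sqint u -> 0 < sqnorm u -> exists n, forall n', (n <= n')%N ->
     k * sqnorm u <= \sum_(a < K n') sqnormc (inner u (e a))) ->
  forall f, sqint f -> forall eps : R, 0 < eps ->
  exists n, sqnorm (residual e (K n) f) < eps.
Proof.
move=> sqe Kmono one /andP[k0 k1] frame f sf eps eps0.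
have step n : exists n', sqnorm (residual e (K n') f) <=
    (1 - k) * sqnorm (residual e (K n) f).
  have sh := residual_square_integrable (K n) sqe sf.
  set h := residual e (K n) f in sh *.
  have [h0|h0] := leP (sqnorm h) 0.
    exists n; have -> : sqnorm h = 0 by apply/eqP; rewrite eq_le h0 sqnorm_ge0.
    by rewrite mulr0.
  have [n0 /(_ (maxn n0 n) (leq_maxl _ _))] := frame h sh h0.
  set n' := maxn n0 n => hn'; exists n'.
  have nn' : (n <= n')%N by exact: leq_maxr.
  (* Only the indices from [K n] on see the residual, and there it has the
     coefficients of [f]. *)
  have split_h : \sum_(a < K n') sqnormc (inner h (e a)) =
      \sum_(a < K n') sqnormc (inner f (e a)) - \sum_(a < K n) sqnormc (inner f (e a)).
    rewrite -[LHS](big_mkord xpredT (fun a => sqnormc (inner h (e a)))).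
    rewrite -!(big_mkord xpredT (fun a => sqnormc (inner f (e a)))).
    rewrite !(@big_cat_nat _ _ _ (K n) 0 (K n')) ?Kmono //=.
    rewrite big_nat_cond big1 ?add0r; last first.
      move=> a /andP[/andP[_ aK] _].
      rewrite (inner_residual_in sqe (one n)) //.
      by rewrite /sqnormc /= expr0n /= addr0.
    rewrite addrAC subrr add0r; apply: eq_big_nat => a /andP[Ka aK].
    rewrite inner_residual // big1 ?subr0 // => i _.
    rewrite (one n') // ?(leq_trans (ltn_ord i)) ?Kmono //.
    by rewrite ltn_eqF ?mulr0 // (leq_trans (ltn_ord i)).
  have hE : sqnorm h = sqnorm f - \sum_(a < K n) sqnormc (inner f (e a)).
    by apply: sqnorm_residual => //; exact: one.
  rewrite (sqnorm_residual sqe (one n')) //; move: hn'; rewrite split_h; lra.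
have iter j : exists n, sqnorm (residual e (K n) f) <= (1 - k) ^+ j * sqnorm f.
  elim: j => [|j [n hn]].
    exists 0%N; rewrite expr0 mul1r sqnorm_residual //; last exact: one.
    by rewrite lerBlDr lerDl; apply: sumr_ge0 => a _; exact: sqnormc_ge0.
  have [n' hn'] := step n; exists n'; rewrite (le_trans hn') // exprS -mulrA.
  by rewrite ler_wpM2l // subr_ge0.
have : (fun j => (1 - k) ^+ j * sqnorm f) @ \oo --> (0 : R).
  rewrite -(mul0r (sqnorm f)); apply: cvgMl; apply: cvg_expr.
  by rewrite ger0_norm; lra.
move=> /cvgrPdist_lt /(_ eps eps0) [j _ /(_ j (leqnn j))] /=.
rewrite sub0r normrN => hj; have [n hn] := iter j; exists n.
by apply: le_lt_trans hn _; apply: le_lt_trans hj; exact: ler_norm.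
Qed.

End InnerProduct.

(** * Integration against a self-similar measure *)

Lemma probability_Rintegral_cst {R : realType}
    (mu : probability (measurableTypeR R) R) (a : R) : \int[mu]_x a = a.
Proof.
rewrite Rintegral_cst; last exact: measurableT.
by rewrite -[RHS]mulr1; congr (_ * _); exact: (congr1 fine (probability_setT mu)).
Qed.

Section SelfSimilar.
Context {R : realType}.
Variables (q b : nat) (mu : probability (measurableTypeR R) R).
Hypotheses (q_gt0 : (0 < q)%N) (qb : (q < b)%N) (hmu : self_similar q b mu).
Local Notation T := (measurableTypeR R).
Implicit Types (u v : T -> R) (f g : T -> R[i]).
Local Open Scope complex_scope.

Let q_neq0 : q%:R != 0 :> R. Proof. by rewrite pnatr_eq0 -lt0n. Qed.
Let b_gt0 : (0 < b)%N. Proof. exact: leq_trans qb. Qed.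
Let b_neq0 : b%:R != 0 :> R. Proof. by rewrite pnatr_eq0 -lt0n. Qed.

Lemma measurable_ifs_map i : measurable_fun setT (ifs_map b i : T -> T).
Proof. by apply: measurable_funM => //; exact: measurable_funD. Qed.

Let pushed (i : nat) : {measure set T -> \bar R}.
Proof.
by refine (pushforward mu (ifs_map b i : T -> T)); exact: measurable_ifs_map.
Defined.

Let qinv : {nonneg R} := NngNum (ler0n R q).

Let branch (i : nat) : {measure set T -> \bar R} := mscale (qinv%:num^-1)%:nng (pushed i).

(** Self-similarity says that [mu] is the average of its images under the maps of
    the iterated function system; integrals are then transported map by map. *)
Lemma self_similar_ge0_integral (u : T -> R) :
  measurable_fun setT u -> (forall x, 0 <= u x) ->
  (\int[mu]_x (u x)%:E =
   \sum_(i < q) (q%:R^-1)%:E * \int[mu]_x (u (ifs_map b i x))%:E)%E.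
Proof.
move=> mu_ u0.
have muE : measurable_fun setT (EFin \o u) by exact/measurable_EFinP.
rewrite (@eq_measure_integral _ _ _ _ (msum branch q)); last first.
  by move=> A mA _; exact: hmu.
rewrite ge0_integral_measure_sum //; last by move=> x _; rewrite lee_fin.
apply: eq_bigr => i _; rewrite ge0_integral_mscale //; last first.
  by move=> x _; rewrite lee_fin.
congr (_ * _)%E.
rewrite (ge0_integral_pushforward (measurable_ifs_map i) mu measurableT muE) //.
by move=> x _; rewrite lee_fin.
Qed.

(** Adding a constant makes a bounded function nonnegative, and both sides change by
    that constant. *)
Lemma self_similar_Rintegral u : bounded_mfun u ->
  \int[mu]_x u x = q%:R^-1 * \sum_(i < q) \int[mu]_x u (ifs_map b i x).
Proof.
move=> bu; have [M uM] := bu.2.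
have buM : bounded_mfun (fun x => u x + M).
  by apply: bounded_mfunD bu (bounded_mfun_cst _).
have shift v : bounded_mfun v -> \int[mu]_x (v x + M) = \int[mu]_x v x + M.
  move=> bv; rewrite RintegralD //; try exact: bounded_mfun_integrable.
    by rewrite probability_Rintegral_cst.
  exact: (bounded_mfun_integrable mu (bounded_mfun_cst M)).
have comp i : bounded_mfun (fun x => u (ifs_map b i x)).
  exact: (bounded_mfun_comp (measurable_ifs_map i) bu).
(* The nonnegative case applies to [u + M]. *)
apply: (addIr M); rewrite -shift // /Rintegral.
rewrite self_similar_ge0_integral; [|by case: buM|]; last first.
  by move=> x; rewrite -lerBlDr sub0r; have := uM x; rewrite ler_norml => /andP[].
have fin i : (\int[mu]_x (u (ifs_map b i x) + M)%:E =
    (\int[mu]_x u (ifs_map b i x) + M)%:E)%E.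
  rewrite -shift // fineK //; apply: integrable_fin_num => //.
  apply: (bounded_mfun_integrable mu); exact: bounded_mfunD (comp i) (bounded_mfun_cst _).
under eq_bigr do rewrite fin -EFinM.
rewrite sumEFin /= -mulr_sumr big_split /= mulrDr; congr (_ + _).
by rewrite sumr_const card_ord -[M *+ q]mulr_natl mulrA mulVf // mul1r.
Qed.

(** The left endpoints of the level-[n] cylinders, multiplied by [b ^ n]. *)
Fixpoint nodes n : seq nat :=
  if n is n'.+1 then [seq (i + b * k)%N | k <- nodes n', i <- iota 0 q] else [:: 0%N].

Lemma size_nodes n : size (nodes n) = (q ^ n)%N.
Proof. by elim: n => //= n IH; rewrite size_allpairs IH size_iota -expnSr. Qed.

(** For a node [k], the composite of [n] maps of the system that sends [0] to
    [k / b ^ n]. *)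
Definition zoom n (k : nat) (y : T) : T := (k%:R + y) / b%:R ^+ n.

Lemma measurable_zoom n k : measurable_fun setT (zoom n k).
Proof. by apply: measurable_funM => //; exact: measurable_funD. Qed.

Lemma zoomS n k i y : zoom n k (ifs_map b i y) = zoom n.+1 (i + b * k) y.
Proof.
rewrite /zoom /ifs_map natrD natrM exprSr.
have bn : b%:R ^+ n != 0 :> R by rewrite expf_neq0.
by field; rewrite bn b_neq0.
Qed.

Lemma self_similar_nodes u n : bounded_mfun u ->
  \int[mu]_x u x = (q%:R ^+ n)^-1 * \sum_(k <- nodes n) \int[mu]_x u (zoom n k x).
Proof.
move=> bu; elim: n => [|n ->].
  rewrite expr0 invr1 mul1r big_seq1; apply: eq_Rintegral => x _.
  by rewrite /zoom expr0 divr1 add0r.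
rewrite exprSr invfM -mulrA [in RHS]big_allpairs_dep /=; congr (_ * _).
rewrite mulr_sumr; apply: eq_bigr => k _.
rewrite self_similar_Rintegral; last exact: (bounded_mfun_comp (measurable_zoom n k) bu).
congr (_ * _); rewrite -(big_mkord xpredT (fun i =>
   \int[mu]_x u (zoom n k (ifs_map b i x)))) /index_iota subn0.
by apply: eq_bigr => i _; apply: eq_Rintegral => x _; rewrite zoomS.
Qed.

Lemma self_similar_cintegral f n : cbounded f ->
  cintegral mu f =
    ((q%:R ^+ n)^-1)%:C * \sum_(k <- nodes n) cintegral mu (fun x => f (zoom n k x)).
Proof.
move=> [fr fi]; rewrite /cintegral; apply: complex_eqP.
  rewrite Re_mul /= mul0r subr0 (self_similar_nodes n fr); congr (_ * _).
  by elim: (nodes n) => [|k s IH]; rewrite ?big_nil // !big_cons IH Re_add.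
rewrite Im_mul /= mul0r addr0 (self_similar_nodes n fi); congr (_ * _).
by elim: (nodes n) => [|k s IH]; rewrite ?big_nil // !big_cons IH Im_add.
Qed.

End SelfSimilar.

Section AdicConstant.
Context {R : realType} (b : nat) (C : Type).
Hypothesis b_gt0 : (0 < b)%N.
Implicit Types s : measurableTypeR R -> C.

Definition adic_constant n s : Prop :=
  forall (k : nat) (y : R), 0 <= y < 1 -> s (zoom b n k y) = s (zoom b n k 0).

(** A [b]-adic interval of level [n'.+1] lies in one of level [n']. *)
Lemma adic_constant_le n n' s : (n <= n')%N -> adic_constant n s -> adic_constant n' s.
Proof.
move=> nn' hs; elim: n' nn' => [|n' IH]; first by rewrite leqn0 => /eqP <-.
rewrite leq_eqVlt => /orP[/eqP <- //|]; rewrite ltnS => /IH {}hs.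
move=> k y /andP[y0 y1]; rewrite (divn_eq k b) mulnC addnC.
have b0 : 0 < b%:R :> R by rewrite ltr0n.
have key (z : R) : 0 <= z < 1 -> s (zoom b n'.+1 (k %% b + b * (k %/ b)) z) =
    s (zoom b n' (k %/ b) 0).
  move=> /andP[z0 z1]; rewrite -(zoomS b_gt0) // hs //; apply/andP; split.
    by rewrite mulr_ge0 ?invr_ge0 ?addr_ge0 // ler0n.
  rewrite /ifs_map mulrC ltr_pdivrMr // mul1r.
  have : (k %% b).+1%:R <= b%:R :> R by rewrite ler_nat ltn_mod.
  by rewrite -natr1; lra.
by rewrite !key ?lexx ?ltr01 // y0.
Qed.

End AdicConstant.

(** * The support of the measure *)

Section Support.
Context {R : realType}.
Variables (q b : nat) (mu : probability (measurableTypeR R) R).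
Hypotheses (q_gt0 : (0 < q)%N) (qb : (q < b)%N) (hmu : self_similar q b mu).
Local Notation T := (measurableTypeR R).
Implicit Types (u : T -> R) (f : T -> R[i]).

(** The fixed point of the last map, which is the right end of the attractor. *)
Definition attractor_end : R := q.-1%:R / b.-1%:R.
Local Notation kap := attractor_end.

Let b1_gt0 : 0 < b.-1%:R :> R.
Proof. by rewrite ltr0n -subn1 subn_gt0; exact: leq_ltn_trans qb. Qed.
Let bE : b%:R = b.-1%:R + 1 :> R.
Proof. by rewrite natr1 prednK //; exact: ltn_trans qb. Qed.

Lemma attractor_end_ge0 : 0 <= kap.
Proof. by rewrite divr_ge0 // ler0n. Qed.

Lemma attractor_end_lt1 : kap < 1.
Proof. by rewrite ltr_pdivrMr // mul1r ltr_nat; move: q_gt0 qb; lia. Qed.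

Let kapE : kap * b%:R = kap + q.-1%:R.
Proof. by rewrite bE mulrDr mulr1 divfK ?gt_eqF // addrC. Qed.

Let outside (t : R) : set T := ~` `[- t, kap + t].

Let measurable_outside t : measurable (outside t).
Proof. by apply: measurableC; exact: measurable_itv. Qed.

Let outside_le s t : s <= t -> outside t `<=` outside s.
Proof.
move=> st; apply: subsetC => x /=; rewrite !in_itv /= => /andP[a c].
by apply/andP; split; lra.
Qed.

Let outside_preimage (i : nat) t : (i < q)%N -> 0 <= t ->
  (ifs_map b i : T -> T) @^-1` outside t `<=` outside (b%:R * t).
Proof.
move=> iq t0; rewrite /outside preimage_setC; apply: subsetC => y /=.
have b0 : 0 < b%:R :> R by rewrite bE ltr_pwDr // ltW.
have i0 : 0 <= i%:R :> R by rewrite ler0n.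
have i1 : i%:R <= q.-1%:R :> R by rewrite ler_nat -ltnS prednK.
rewrite /ifs_map !in_itv /= [b%:R^-1 * _]mulrC => /andP[y1 y2].
rewrite ler_pdivlMr // ler_pdivrMr // mulrDl kapE.
by apply/andP; split; lra.
Qed.

Let outside_step t : 0 <= t -> (mu (outside t) <= mu (outside (b%:R * t)))%E.
Proof.
move=> t0; rewrite hmu //.
apply: (@le_trans _ _ (\sum_(i < q) (q%:R^-1)%:E * mu (outside (b%:R * t)))%E).
  apply: lee_sum => i _; apply: lee_wpmul2l; first by rewrite lee_fin invr_ge0 ler0n.
  apply: le_measure; rewrite ?inE //; last exact: outside_preimage.
  by rewrite -[X in measurable X]setTI; apply: measurable_ifs_map.
have fin : mu (outside (b%:R * t)) \is a fin_num by exact: fin_num_measure.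
rewrite -(fineK fin); under eq_bigr do rewrite -EFinM.
rewrite sumEFin lee_fin sumr_const card_ord -[X in X <= _]mulr_natl mulrA mulfV ?mul1r //.
by rewrite pnatr_eq0 -lt0n.
Qed.

Let outside_null t : 0 < t -> mu (outside t) = 0%E.
Proof.
move=> t0; pose F n := outside (b%:R ^+ n * t).
have b1 : 1 < b%:R :> R by rewrite bE ltrDr.
have Fge n : (mu (outside t) <= mu (F n))%E.
  elim: n => [|n IH]; first by rewrite /F expr0 mul1r.
  apply: le_trans IH _; rewrite /F exprS -mulrA; apply: outside_step.
  by rewrite mulr_ge0 ?exprn_ge0 ?ler0n // ltW.
have F0 : \bigcap_n F n = set0.
  rewrite -subset0 => x Fx.
  have := archi_boundP (divr_ge0 (normr_ge0 x) (ltW t0)); set n := Num.bound _ => hn.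
  apply: (Fx n I); rewrite /= in_itv /=.
  have : `|x| <= b%:R ^+ n * t.
    move: hn; rewrite ltr_pdivrMr // => /ltW hn; apply: le_trans hn _.
    by rewrite ler_pM2r // -natrX ler_nat ltnW // ltn_expl // -(ltr_nat R).
  by rewrite ler_norml => /andP[h1 h2]; have := attractor_end_ge0; lra.
have cv : mu \o F @ \oo --> (0 : \bar R)%E.
  rewrite -[X in _ --> X](measure0 mu) -F0; apply: nonincreasing_cvg_mu => //.
  - apply: le_lt_trans (ltry 1); apply: probability_le1; exact: measurable_outside.
  - by move=> n; exact: measurable_outside.
  - by rewrite F0.
  - move=> m n mn; apply/subsetPset; apply: outside_le.
    by rewrite ler_pM2r // ler_weXn2l // ltW.
apply/eqP; rewrite eq_le measure_ge0 andbT -(cvg_lim _ cv) //.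
by apply: lime_ge; [exact: cvgP cv|exact: nearW].
Qed.

(** The maps contract towards the attractor, so the mass outside a neighbourhood of
    [0, attractor_end] of radius [t] is at most the mass outside the one of radius
    [b ^ n * t], which tends to [0]. *)
Lemma attractor_full : \forall x \ae mu, 0 <= x <= kap.
Proof.
exists (\bigcup_n outside n.+1%:R^-1); split.
- by apply: bigcupT_measurable => n; exact: measurable_outside.
- apply: measure_negligible.
    by apply: bigcupT_measurable => n; exact: measurable_outside.
  apply: negligible_bigcup => n; apply/negligibleP => //.
  by apply: outside_null; rewrite invr_gt0 ltr0n.
- have below (y z : R) : y + z < 0 -> - z <= y -> False by lra.
  have above (y z : R) : kap + z < y -> y <= kap + z -> False by lra.
  move=> x /= /negP; rewrite negb_and -!ltNge => /orP[x0|x0].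
    have [n hn] := ltr_add_invr x0; exists n => //; rewrite /outside /=.
    rewrite in_itv /= => /andP[+ _]; exact: below hn.
  have [n hn] := ltr_add_invr x0; exists n => //; rewrite /outside /=.
  by rewrite in_itv /= => /andP[_]; exact: above hn.
Qed.

(** Composing with this retraction does not change integrals ([Rintegral_clip]),
    and it turns almost-everywhere bounds on the support into pointwise ones. *)
Definition clip (x : T) : T := Num.max 0 (Num.min x kap).

Lemma measurable_clip : measurable_fun setT clip.
Proof. by apply: measurable_maxr => //; exact: measurable_minr. Qed.

Lemma clip_itv x : 0 <= clip x <= kap.
Proof.
rewrite /clip le_max lexx /= ge_max attractor_end_ge0 /=.
by rewrite ge_min lexx orbT.
Qed.

Lemma clip_id x : 0 <= x <= kap -> clip x = x.
Proof. by move=> /andP[x0 x1]; rewrite /clip min_l // max_r. Qed.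

Lemma Rintegral_clip u : bounded_mfun u -> \int[mu]_x u x = \int[mu]_x u (clip x).
Proof.
move=> bu; have [mc _] := bounded_mfun_comp measurable_clip bu.
congr fine; apply: ae_eq_integral => //.
- by apply/measurable_EFinP; case: bu.
- exact/measurable_EFinP.
- have [A [mA A0 sub]] := attractor_full; exists A; split=> //.
  by apply: subset_trans sub; apply: subsetC => x /= hx _; rewrite clip_id.
Qed.

Lemma cintegral_clip f : cbounded f ->
  cintegral mu f = cintegral mu (fun x => f (clip x)).
Proof. by move=> [fr fi]; rewrite /cintegral !(Rintegral_clip fr, Rintegral_clip fi). Qed.

End Support.

(** * The Fourier transform at adic levels *)

Section Fourier.
Context {R : realType}.
Variables (q b : nat) (mu : probability (measurableTypeR R) R).
Hypotheses (q_gt0 : (0 < q)%N) (qb : (q < b)%N) (hmu : self_similar q b mu).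
Local Notation T := (measurableTypeR R).
Implicit Types (f s : T -> R[i]) (t : R).
Local Open Scope complex_scope.
Local Notation inner := (L2inner mu).

Let q_neq0 : q%:R != 0 :> R. Proof. by rewrite pnatr_eq0 -lt0n. Qed.
Let b_gt0 : (0 < b)%N. Proof. exact: leq_trans qb. Qed.
Let b_neq0 : b%:R != 0 :> R. Proof. by rewrite pnatr_eq0 -lt0n. Qed.

Definition fourier t : R[i] := cintegral mu (cexpo t).

Definition mask t : R[i] := (q%:R^-1)%:C * \sum_(i < q) expi (2 * pi * t * i%:R).

(** The Fourier transform of the uniform measure on the level-[n] endpoints. *)
Definition level_mask n t : R[i] :=
  ((q%:R ^+ n)^-1)%:C * \sum_(k <- nodes q b n) expi (2 * pi * t * (k%:R / b%:R ^+ n)).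

Lemma inner_cexpo t t' : inner (cexpo t) (cexpo t') = fourier (t - t').
Proof.
congr cintegral; apply/funext => x.
by rewrite !cexpoE conj_expi -expiD; congr expi; ring.
Qed.

Lemma fourier0 : fourier 0 = 1.
Proof.
have -> : fourier 0 = cintegral mu (fun=> 1).
  by congr cintegral; apply/funext => x; rewrite cexpoE mulr0 mul0r expi0.
by apply: complex_eqP; exact: probability_Rintegral_cst.
Qed.

(** Bessel's inequality for the single exponential of frequency [0]. *)
Lemma sqnormc_fourier_le1 t : sqnormc (fourier t) <= 1.
Proof.
have e0 (l : R) : csquare_integrable mu (cexpo l).
  by apply: cbounded_square_integrable; exact: cbounded_cexpo.
have one0 (a a' : nat) : (a < 1)%N -> (a' < 1)%N ->
    inner (cexpo 0) (cexpo 0) = (a == a')%:R.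
  by case: a a' => [|//] [|//] _ _; rewrite inner_cexpo subrr fourier0.
have := bessel (fun=> e0 0) one0 (e0 t).
rewrite big_ord1 inner_cexpo subr0.
suff -> : sqnorm mu (cexpo t) = 1 by [].
by apply: complexI; rewrite -inner_sqnorm inner_cexpo subrr fourier0.
Qed.

Lemma cexpo_zoom t n k (y : T) :
  cexpo t (zoom b n k y) =
  expi (2 * pi * t * (k%:R / b%:R ^+ n)) * cexpo (t / b%:R ^+ n) y.
Proof.
rewrite !cexpoE -expiD; congr expi; rewrite /zoom.
have bn : b%:R ^+ n != 0 :> R by rewrite expf_neq0.
by field.
Qed.

Lemma fourier_level n t : fourier t = level_mask n t * fourier (t / b%:R ^+ n).
Proof.
rewrite /fourier (self_similar_cintegral q_gt0 qb hmu n); last exact: cbounded_cexpo.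
rewrite /level_mask -mulrA mulr_suml; congr (_ * _); apply: eq_bigr => k _.
rewrite -cintegralZ; last by apply: cbounded_integrable; exact: cbounded_cexpo.
by congr cintegral; apply/funext => y; rewrite cexpo_zoom.
Qed.

Lemma level_maskS n t : level_mask n.+1 t = mask (t / b%:R ^+ n.+1) * level_mask n t.
Proof.
rewrite /level_mask /mask !exprSr invfM rmorphM /= big_allpairs_dep /=.
rewrite -!mulrA mulrCA; congr (_ * _); rewrite [RHS]mulrCA; congr (_ * _).
rewrite -(big_mkord xpredT (fun i => expi (2 * (pi * (t / (b%:R ^+ n * b%:R))) * i%:R))).
rewrite mulr_sumr; apply: eq_bigr => k _; rewrite mulr_suml /index_iota subn0.
apply: eq_bigr => i _; rewrite -expiD; congr expi; rewrite natrD natrM.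
have bn : b%:R ^+ n != 0 :> R by rewrite expf_neq0.
by field; rewrite bn b_neq0.
Qed.

Lemma level_mask_eq0 n j t : (j < n)%N -> mask (t / b%:R ^+ j.+1) = 0 ->
  level_mask n t = 0.
Proof.
move=> jn m0; elim: n jn => // n IH; rewrite ltnS leq_eqVlt => /orP[/eqP <-|jn].
  by rewrite level_maskS m0 mul0r.
by rewrite level_maskS IH // mulr0.
Qed.

(** A frequency [b ^ (n + j)] is invisible on the endpoints of level [n]. *)
Lemma level_mask_period n j t :
  level_mask n (t + b%:R ^+ (n + j)) = level_mask n t.
Proof.
congr (_ * _); apply: eq_bigr => k _.
have bn : b%:R ^+ n != 0 :> R by rewrite expf_neq0.
have -> : 2 * pi * (t + b%:R ^+ (n + j)) * (k%:R / b%:R ^+ n) =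
   2 * pi * t * (k%:R / b%:R ^+ n) + 2 * pi * (b ^ j * k)%:R :> R.
  by rewrite natrM natrX exprD; field.
by rewrite expiD expi_nat mulr1.
Qed.

Definition level_step n s : Prop := cbounded s /\ adic_constant b n s.

Lemma cintegral_level_step n s f : level_step n s -> cbounded f ->
  cintegral mu (fun x => s x * f x) = ((q%:R ^+ n)^-1)%:C *
   \sum_(k <- nodes q b n) s (zoom b n k 0) * cintegral mu (fun y => f (zoom b n k y)).
Proof.
move=> [bs hs] bf; rewrite (self_similar_cintegral q_gt0 qb hmu n); last exact: cboundedM.
congr (_ * _); apply: eq_bigr => k _.
have bz g : cbounded g -> cbounded (fun y => g (zoom b n k y)).
  by apply: cbounded_comp; exact: measurable_zoom.
rewrite -cintegralZ; last by apply: cbounded_integrable; exact: bz.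
rewrite (cintegral_clip q_gt0 qb hmu); last by apply: cboundedM; exact: bz.
rewrite [RHS](cintegral_clip q_gt0 qb hmu); last first.
  by apply: cboundedM; [exact: cbounded_cst|exact: bz].
congr cintegral; apply/funext => y; rewrite hs //.
have /andP[-> h] := clip_itv q b y; exact: le_lt_trans h (attractor_end_lt1 q_gt0 qb).
Qed.

(** On each cylinder [s] is a constant, and the exponential factors into its value
    at the endpoint and an exponential of frequency [t / b ^ n]. *)
Lemma inner_level_step n s t : level_step n s ->
  inner s (cexpo t) = ((q%:R ^+ n)^-1)%:C * (\sum_(k <- nodes q b n)
    s (zoom b n k 0) * ((expi (2 * pi * t * (k%:R / b%:R ^+ n)))^*)%R) *
    ((fourier (t / b%:R ^+ n))^*)%R.
Proof.
move=> hs; rewrite /L2inner (cintegral_level_step hs); last first.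
  by apply: cbounded_conj; exact: cbounded_cexpo.
rewrite -mulrA mulr_suml; congr (_ * _); apply: eq_bigr => k _.
rewrite -mulrA; congr (_ * _).
rewrite -cintegral_conj; last by apply: cbounded_integrable; exact: cbounded_cexpo.
rewrite -cintegralZ; last first.
  by apply: cbounded_integrable; apply: cbounded_conj; exact: cbounded_cexpo.
by congr cintegral; apply/funext => y; rewrite cexpo_zoom rmorphM.
Qed.

Lemma sqnorm_level_step n s : level_step n s ->
  sqnorm mu s = (q%:R ^+ n)^-1 * \sum_(k <- nodes q b n) sqnormc (s (zoom b n k 0)).
Proof.
move=> hs; apply: complexI; rewrite -inner_sqnorm /L2inner.
rewrite (cintegral_level_step hs); last by apply: cbounded_conj; case: hs.
rewrite rmorphM /=; congr (_ * _); rewrite rmorph_sum /=; apply: eq_bigr => k _.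
rewrite -mul_conjc_sqnormc; congr (_ * _).
rewrite (cintegral_clip q_gt0 qb hmu); last first.
  by apply: cbounded_conj; exact: (cbounded_comp (measurable_zoom b n k) (proj1 hs)).
have e (y : T) : s (zoom b n k (clip q b y)) = s (zoom b n k 0).
  case: hs => _ -> //; have /andP[-> h] := clip_itv q b y.
  exact: le_lt_trans h (attractor_end_lt1 q_gt0 qb).
rewrite /cintegral; apply: complex_eqP => /=; under eq_Rintegral do rewrite e;
  exact: probability_Rintegral_cst.
Qed.

End Fourier.

(** * A lower bound for the Fourier transform *)

Section FourierLowerBound.
Context {R : realType}.
Variables (q b : nat) (mu : probability (measurableTypeR R) R).
Hypotheses (q_gt0 : (0 < q)%N) (b_gt2 : (2 < b)%N) (qb2 : (2 * q <= b)%N).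
Hypothesis hmu : self_similar q b mu.
Local Notation T := (measurableTypeR R).
Local Open Scope complex_scope.

Let qb : (q < b)%N. Proof. by move: q_gt0 qb2; lia. Qed.

(** An upper bound, strictly below a quarter turn, for half of the arc described by
    the exponential of frequency [t <= b / (b - 1)] on the support. *)
Definition half_spread : R := pi / 2 * (1 - (b.-1%:R ^+ 2)^-1).

Let B : R := b.-1%:R.
Let bE : b%:R = B + 1 :> R.
Proof. by rewrite natr1 prednK //; exact: ltn_trans b_gt2. Qed.
Let B_ge2 : 2 <= B. Proof. by rewrite ler_nat; move: b_gt2; case: (b). Qed.

Lemma half_spread_itv : 0 <= half_spread < pi / 2.
Proof.
have p0 := pi_gt0 R; have B4 : 1 <= B ^+ 2 by have := B_ge2; nra.
have B2 : 0 < B ^+ 2 by lra.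
have B0 : 0 < (B ^+ 2)^-1 by rewrite invr_gt0.
have B1 : (B ^+ 2)^-1 <= 1 by rewrite invf_le1.
rewrite /half_spread; apply/andP; split.
  by rewrite mulr_ge0 ?divr_ge0 ?subr_ge0 // ltW.
by rewrite -[X in _ < X]mulr1 ltr_pM2l ?divr_gt0 //; lra.
Qed.

Definition fourier_bound : R := cos half_spread.

Lemma fourier_bound_gt0 : 0 < fourier_bound.
Proof.
have := half_spread_itv => /andP[h0 h1].
by apply: cos_gt0_pihalf; apply/andP; split=> //; have := pi_gt0 R; lra.
Qed.

Lemma fourier_bound_le1 : fourier_bound <= 1.
Proof. exact: cos_le1. Qed.

(** After a rotation that centres the arc, the integrand has real part at least
    [cos half_spread].  The half-arc is [pi * t * attractor_end], and
    [b (q - 1) / (b - 1) ^ 2] is at most [(1 - 1 / (b - 1) ^ 2) / 2] because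
    [2 q <= b]. *)
Lemma fourier_lower_bound t : 0 <= t <= b%:R / b.-1%:R ->
  fourier_bound ^+ 2 <= sqnormc (fourier mu t).
Proof.
move=> /andP[t0 t1]; pose kap : R := attractor_end q b; pose phi := pi * t * kap.
have p0 := pi_gt0 R; have k0 : 0 <= kap by exact: attractor_end_ge0.
have B2 : 2 <= B by exact: B_ge2.
have B0 : 0 < B by lra.
have phi0 : 0 <= phi by rewrite !mulr_ge0 // ltW.
have phi1 : phi <= half_spread.
  rewrite /phi /half_spread -!mulrA ler_pM2l //.
  apply: (@le_trans _ _ (b%:R / B * kap)); first by rewrite ler_wpM2r.
  rewrite /kap /attractor_end -/B bE.
  have q2 : 2 * q.-1%:R + 2 <= B + 1 :> R.
    by rewrite -bE -(natrM _ 2) -natrD ler_nat; move: q_gt0 qb2; lia.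
  have -> : (B + 1) / B * (q.-1%:R / B) = ((B + 1) * q.-1%:R) / B ^+ 2.
    by field; rewrite gt_eqF.
  have -> : 2^-1 * (1 - (B ^+ 2)^-1) = (B ^+ 2 - 1) / 2 / B ^+ 2 by field; rewrite gt_eqF.
  by rewrite ler_pM2r ?invr_gt0 ?exprn_gt0 //; nra.
have [h0 h1] := andP half_spread_itv.
(* The angle [phi] is the phase at the midpoint of the support. *)
pose f (x : T) := expi (- phi) * cexpo t x.
have bf : cbounded f by apply: cboundedM (cbounded_cst _) (cbounded_cexpo _).
have fE (x : T) : Re (f x) = cos (pi * t * (2 * x - kap)).
  by rewrite /f cexpoE -expiD /=; congr cos; rewrite /phi; ring.
have le1 : fourier_bound <= Re (expi (- phi) * fourier mu t).
  rewrite -cintegralZ; last exact: cbounded_integrable (cbounded_cexpo _).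
  rewrite (cintegral_clip q_gt0 qb hmu bf).
  change (fourier_bound <= \int[mu]_x Re (f (clip q b x))).
  rewrite -[leLHS](probability_Rintegral_cst mu); apply: le_Rintegral => //.
  - exact: (bounded_mfun_integrable mu (bounded_mfun_cst _)).
  - exact: (bounded_mfun_integrable mu (bounded_mfun_comp (measurable_clip q b) bf.1)).
  move=> x _; rewrite fE; have /andP[c0 c1] := clip_itv q b x.
  set z := pi * t * _; have z_le : `|z| <= half_spread.
    rewrite normrM (ger0_norm (mulr_ge0 (ltW p0) t0)).
    apply: le_trans phi1; rewrite /phi; apply: ler_wpM2l.
      by rewrite mulr_ge0 // ltW.
    by rewrite ler_norml; apply/andP; split; rewrite /kap; lra.
  have z0 := normr_ge0 z.
  rewrite -[cos z]cos_norm leNgt ltr_cos; first by rewrite -leNgt.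
    by rewrite in_itv /=; apply/andP; split=> //; lra.
  by rewrite in_itv /=; apply/andP; split=> //; lra.
apply: (@le_trans _ _ (Re (expi (- phi) * fourier mu t) ^+ 2)).
  by rewrite lerXn2r ?nnegrE // ?ltW ?fourier_bound_gt0 // (lt_le_trans fourier_bound_gt0).
rewrite -[leRHS]mul1r -(sqnormc_expi (- phi)) -sqnormcM /sqnormc lerDl.
exact: sqr_ge0.
Qed.

End FourierLowerBound.

(** * Square unitary matrices *)

Section Unitary.
Variable R : realType.
Local Open Scope complex_scope.

(** Orthogonality is assumed for the rows; a one-sided inverse of a square matrix
    is two-sided, so the columns are orthogonal as well. *)
Lemma unitary_parseval (L : nat) (V : 'M[R[i]]_L) (x : 'I_L -> R[i]) :
  (0 < L)%N ->
  (forall a a', \sum_j V a j * ((V a' j)^*)%R = (L%:R * (a == a')%:R)) ->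
  \sum_a sqnormc (\sum_j V a j * x j) = L%:R * \sum_j sqnormc (x j).
Proof.
move=> L0 orth; pose W := map_mx Num.conj V^T.
have L_neq0 : L%:R != 0 :> R[i] by rewrite pnatr_eq0 -lt0n.
have VW : V *m (L%:R^-1 *: W) = 1%:M.
  apply/matrixP => a a'; rewrite -scalemxAr !mxE.
  under eq_bigr do rewrite !mxE.
  by rewrite orth mulrA mulVf // mul1r.
have WV : W *m V = L%:R%:M.
  have := mulmx1C VW; rewrite -scalemxAl => /(congr1 ( *:%R L%:R)).
  by rewrite scalerA mulfV // scale1r scalemx1.
pose X : 'cV[R[i]]_L := \col_j x j.
have sqE (Y : 'cV[R[i]]_L) : (map_mx Num.conj Y^T *m Y) 0 0 = (\sum_j sqnormc (Y j 0))%:C.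
  rewrite mxE rmorph_sum /=; apply: eq_bigr => j _.
  by rewrite !mxE mulrC mul_conjc_sqnormc.
have XE j : X j 0 = x j by rewrite mxE.
have VXE a : (V *m X) a 0 = \sum_j V a j * x j.
  by rewrite mxE; apply: eq_bigr => j _; rewrite XE.
apply: complexI; rewrite rmorphM /= rmorph_nat.
under eq_bigr do rewrite -VXE; under [in RHS]eq_bigr do rewrite -XE.
rewrite -!sqE trmx_mul map_mxM /= -mulmxA (mulmxA _ V) WV mul_scalar_mx -scalemxAr.
by rewrite mxE.
Qed.

End Unitary.

(** * The sparse exponentials at a finite level *)

Section SparseExponentials.
Context {R : realType}.
Variables (q m : nat) (N : nat -> nat) (mu : probability (measurableTypeR R) R).
Hypotheses (q_gt0 : (0 < q)%N) (m_gt1 : (1 < m)%N) (b_gt2 : (2 < q * m)%N).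
Hypothesis N_large : forall a n, (a < q ^ n)%N -> (a < q ^ N a)%N.
Hypothesis hmu : self_similar q (q * m) mu.
Local Notation T := (measurableTypeR R).
Local Open Scope complex_scope.
Local Notation b := (q * m)%N.
Local Notation lam a := ((freq q m N a)%:R : R).
Local Notation inner := (L2inner mu).
Local Notation fb := (fourier_bound b : R).

Let q_neq0 : q%:R != 0 :> R. Proof. by rewrite pnatr_eq0 -lt0n. Qed.
Let qb : (q < b)%N. Proof. by rewrite -[X in (X < _)%N]muln1 ltn_pmul2l. Qed.
Let qb2 : (2 * q <= b)%N. Proof. by rewrite mulnC leq_pmul2l. Qed.

Lemma mask_root (Y Y' : nat) : (Y %% q != Y' %% q)%N ->
  mask q ((Y%:R - Y'%:R) / q%:R : R) = 0.
Proof. by move=> YY'; rewrite /mask expi_root_sum // mulr0. Qed.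

(** The factor of the mask product at the first differing digit vanishes. *)
Lemma level_mask_freq n a a' : (a < q ^ n)%N -> (a' < q ^ n)%N -> a != a' ->
  level_mask q b n (lam a - lam a') = 0.
Proof.
move=> an an' aa'.
have [j [X [Y [Y' [jn -> -> YY']]]]] := freq_separation m q_gt0 N_large an an' aa'.
apply: (level_mask_eq0 qb jn); rewrite -[RHS](mask_root YY'); congr mask.
rewrite !natrM !natrD !natrM !natrX exprSr natrM.
have m_neq0 : m%:R != 0 :> R by rewrite pnatr_eq0 -lt0n ltnW.
have h : (q%:R * m%:R) ^+ j != 0 :> R by rewrite expf_neq0 // mulf_neq0.
by field; rewrite q_neq0 m_neq0 h.
Qed.

Lemma cexpo_freq_orthonormal n a a' : (a < q ^ n)%N -> (a' < q ^ n)%N ->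
  inner (cexpo (lam a)) (cexpo (lam a')) = (a == a')%:R.
Proof.
move=> an an'; rewrite inner_cexpo; have [->|aa'] := eqVneq a a'.
  by rewrite subrr fourier0.
by rewrite (fourier_level q_gt0 qb hmu n) level_mask_freq // mul0r.
Qed.

(** Without a far digit above level [n] the argument is in the range of
    [fourier_lower_bound].  With one, [j] levels above, the argument is [th + b ^ j]:
    its first [j] mask factors are those of [th], hence at least
    the Fourier transform at [th] in modulus, and the remaining factors give the Fourier
    transform at [1 + th / b ^ j], which is again in that range.  Each case costs at most
    two factors [fourier_bound]. *)
Lemma fourier_freq_bound n a : (a < q ^ n)%N ->
  fb ^+ 4 <= sqnormc (fourier mu (lam a / b%:R ^+ n)).
Proof.
move=> an; have k0 : 0 < fb by exact: fourier_bound_gt0.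
have k1 : fb ^+ 2 <= 1 by apply: exprn_ile1; [exact: ltW|exact: fourier_bound_le1].
have lower t : 0 <= t <= b%:R / b.-1%:R -> fb ^+ 2 <= sqnormc (fourier mu t).
  exact: (fourier_lower_bound q_gt0 b_gt2 qb2 hmu).
have b1 : 0 < b.-1%:R :> R by rewrite ltr0n; move: b_gt2; case: (b) => [|[|]].
have bn0 i : 0 < b%:R ^+ i :> R by rewrite exprn_gt0 // ltr0n; move: b_gt2; case: (b).
have bn_neq0 i : b%:R ^+ i != 0 :> R by rewrite gt_eqF.
pose th : R := (m * freq_partial q m N n a)%:R / b%:R ^+ n.
have th_itv : 0 <= th <= b%:R / b.-1%:R.
  apply/andP; split; first by rewrite divr_ge0 ?ler0n // ltW.
  rewrite ler_pdivrMr // mulrAC ler_pdivlMr // -natrX -!natrM ler_nat.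
  rewrite -mulnA [(freq_partial _ _ _ _ _ * _)%N]mulnC.
  have := freq_partial_le q_gt0 b_gt2 N_large n a; rewrite -(leq_pmul2l (ltnW m_gt1)).
  by rewrite [(m * (q * _))%N]mulnA (mulnC m q).
have fb42 : fb ^+ 4 <= fb ^+ 2.
  by rewrite (exprD _ 2 2) ler_piMr // exprn_ge0 // ltW.
rewrite (freq_level m q_gt0 N_large an) natrD mulrDl -/th.
case: ifP => nN; last by rewrite mul0r addr0 (le_trans fb42) // lower.
set j := ((N a).+1 - n)%N.
have j0 : (0 < j)%N by rewrite subn_gt0 ltnS.
have -> : (b ^ (N a).+1)%:R / b%:R ^+ n = b%:R ^+ j :> R.
  by rewrite natrX -(subnK (leqW nN)) exprD mulfK.
rewrite (fourier_level q_gt0 qb hmu j).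
rewrite -[X in level_mask _ _ _ (_ + _ ^+ X)]addn0 (level_mask_period qb).
rewrite sqnormcM (exprD _ 2 2); apply: ler_pM; [exact: sqr_ge0|exact: sqr_ge0| |].
  apply: (le_trans (lower _ th_itv)); rewrite (fourier_level q_gt0 qb hmu j) sqnormcM.
  by rewrite ler_piMr ?sqnormc_ge0 // sqnormc_fourier_le1.
apply: lower; rewrite mulrDl mulfV //; have /andP[th0 th1] := th_itv.
apply/andP; split; first by rewrite addr_ge0 // divr_ge0 // ltW.
have -> : b%:R / b.-1%:R = (b.-1%:R)^-1 + 1 :> R.
  have -> : b%:R = 1 + b.-1%:R :> R by rewrite addrC natr1 prednK // (ltn_trans _ b_gt2).
  by rewrite mulrDl mul1r divff // gt_eqF.
rewrite lerD2r ler_pdivrMr //; apply: (le_trans th1); rewrite mulrC.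
rewrite ler_pM2l ?invr_gt0 // -[leLHS]expr1.
by rewrite ler_weXn2l // ler1n (ltn_trans _ b_gt2).
Qed.

Let L n := (q ^ n)%N.
Let node n (j : 'I_(L n)) : nat := nth 0%N (nodes q b n) j.
Let V n : 'M[R[i]]_(L n) :=
  \matrix_(a, j) ((expi (2 * pi * lam a * ((node j)%:R / b%:R ^+ n)))^*)%R.

Let sum_nodes n (F : nat -> R[i]) :
  \sum_(k <- nodes q b n) F k = \sum_(j < L n) F (node j).
Proof. by rewrite (big_nth 0%N) big_mkord size_nodes. Qed.

Let V_orth n a a' : \sum_j V n a j * ((V n a' j)^*)%R = ((L n)%:R * (a == a')%:R).
Proof.
have LC : (L n)%:R * ((q%:R ^+ n)^-1)%:C = 1 :> R[i].
  rewrite (_ : (L n)%:R = (q%:R ^+ n)%:C); last by rewrite -natrX rmorph_nat.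
  by rewrite -rmorphM /= mulfV // expf_neq0.
have -> : ((L n)%:R * (a == a')%:R : R[i]) =
    (L n)%:R * level_mask q b n (lam a' - lam a).
  have [->|aa'] := eqVneq a a'; last by rewrite level_mask_freq // eq_sym.
  rewrite subrr /level_mask; congr (_ * _).
  rewrite (eq_bigr (fun=> 1)); last by move=> k _; rewrite mulr0 mul0r expi0.
  by rewrite sum_nodes sumr_const card_ord mulrC LC.
rewrite /level_mask mulrA LC.
rewrite mul1r sum_nodes; apply: eq_bigr => j _; rewrite !mxE conjCK conj_expi -expiD.
by congr expi; ring.
Qed.

(** Discrete Parseval on the endpoints, with every coefficient damped by a value
    of the Fourier transform that [fourier_freq_bound] keeps away from zero. *)
Lemma level_step_frame n s : level_step b n s ->
  fb ^+ 4 * sqnorm mu s <= \sum_(a < q ^ n) sqnormc (inner s (cexpo (lam a))).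
Proof.
move=> hs; have L0 : (0 < L n)%N by rewrite expn_gt0 q_gt0.
have qn0 : 0 < q%:R ^+ n :> R by rewrite exprn_gt0 // ltr0n.
have := unitary_parseval (fun j => s (zoom b n (node j) 0)) L0 (V_orth (n := n)).
set S := \sum_j sqnormc (s _); move=> hV.
have -> : sqnorm mu s = (q%:R ^+ n)^-1 * S.
  rewrite (sqnorm_level_step q_gt0 qb hmu hs) (big_nth 0%N) big_mkord size_nodes.
  by [].
have -> : fb ^+ 4 * ((q%:R ^+ n)^-1 * S) =
    (q%:R ^+ n)^-1 ^+ 2 * (fb ^+ 4 * ((q ^ n)%:R * S)).
  by rewrite natrX; field; rewrite gt_eqF.
rewrite -hV !mulr_sumr; apply: ler_sum => a _.
rewrite (inner_level_step q_gt0 qb hmu _ hs) !sqnormcM sqnormc_conj sum_nodes.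
rewrite [sqnormc (_%:C)](_ : _ = (q%:R ^+ n)^-1 ^+ 2); last first.
  by rewrite /sqnormc /= expr0n addr0.
rewrite -mulrA; apply: ler_wpM2l; first exact: sqr_ge0.
rewrite mulrC (_ : \sum_j V n a j * _ = \sum_(j < L n) s (zoom b n (node j) 0) *
  ((expi (2 * pi * lam a * ((node j)%:R / b%:R ^+ n)))^*)%R); last first.
  by apply: eq_bigr => j _; rewrite mxE mulrC.
by rewrite ler_wpM2l ?sqnormc_ge0 // fourier_freq_bound.
Qed.

End SparseExponentials.

(** * Density of adic step functions *)

Section StepDensity.
Context {R : realType}.
Variables (b : nat) (mu : probability (measurableTypeR R) R).
Hypothesis b_gt1 : (1 < b)%N.
Local Notation T := (measurableTypeR R).
Implicit Types (u v s : T -> R).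
Local Notation sqint := (square_integrable mu).

Let b_gt0 : 0 < b%:R :> R. Proof. by rewrite ltr0n ltnW. Qed.
Let bn_gt0 n : 0 < b%:R ^+ n :> R. Proof. by rewrite exprn_gt0. Qed.

Definition adic_step n s : Prop := bounded_mfun s /\ adic_constant b n s.

Definition step_approximable u : Prop := sqint u /\
  forall e : R, 0 < e -> exists n s, adic_step n s /\ \int[mu]_x (u x - s x) ^+ 2 <= e.

Lemma square_integrableB u v : sqint u -> sqint v -> sqint (fun x => u x - v x).
Proof.
move=> su sv; apply: square_integrableD => //.
under eq_fun do rewrite -mulN1r.
exact: (square_integrableM (bounded_mfun_cst (-1)) sv).
Qed.

(** The triangle inequality for squared distances, with the factor [2] that avoids
    square roots. *)
Lemma sqdist_triangle u v s : sqint u -> sqint v -> sqint s ->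
  \int[mu]_x (u x - s x) ^+ 2 <=
  2 * \int[mu]_x (u x - v x) ^+ 2 + 2 * \int[mu]_x (v x - s x) ^+ 2.
Proof.
move=> su sv ss.
have [_ i1] := square_integrableB su sv; have [_ i2] := square_integrableB sv ss.
have [_ i3] := square_integrableB su ss.
have iz (r : R) w : mu.-integrable setT (EFin \o w) ->
    mu.-integrable setT (EFin \o (fun x => r * w x)).
  by move=> iw; exact: (integrableZl measurableT r iw).
rewrite -!RintegralZl // -RintegralD //; try exact: iz.
apply: le_Rintegral => //.
  rewrite (_ : _ \o _ = (EFin \o (fun x => 2 * (u x - v x) ^+ 2)) \+
      (EFin \o (fun x => 2 * (v x - s x) ^+ 2))) //.
  by apply: integrableD => //; exact: iz.
by move=> x _; have := sqr_ge0 (u x - v x - (v x - s x)); nra.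
Qed.

Lemma step_approximable_limit u : sqint u ->
  (forall e : R, 0 < e -> exists v, step_approximable v /\
     \int[mu]_x (u x - v x) ^+ 2 <= e) -> step_approximable u.
Proof.
move=> su h; split=> // e e0; have e4 : 0 < e / 4 by lra.
have [v [[sv hv] uv]] := h _ e4; have [n [s [hs vs]]] := hv _ e4.
exists n, s; split=> //.
by have := sqdist_triangle su sv (bounded_square_integrable mu hs.1); lra.
Qed.

Lemma step_approximableD u v : step_approximable u -> step_approximable v ->
  step_approximable (fun x => u x + v x).
Proof.
move=> [su hu] [sv hv]; split; first exact: square_integrableD.
move=> e e0; have e4 : 0 < e / 4 by lra.
have [n [s [hs us]]] := hu _ e4; have [n' [s' [hs' vs]]] := hv _ e4.
have bs := hs.1; have bs' := hs'.1; have b0 := ltnW b_gt1.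
have cs := adic_constant_le b0 (leq_maxl n n') hs.2.
have cs' := adic_constant_le b0 (leq_maxr n n') hs'.2.
exists (maxn n n'), (fun x => s x + s' x); split.
  by split=> [|k y hy]; [exact: bounded_mfunD|rewrite cs // cs'].
have ss := bounded_square_integrable mu bs; have ss' := bounded_square_integrable mu bs'.
have := sqdist_triangle (square_integrableD su sv) (square_integrableD ss sv)
  (square_integrableD ss ss').
have -> : \int[mu]_x (u x + v x - (s x + v x)) ^+ 2 = \int[mu]_x (u x - s x) ^+ 2.
  by apply: eq_Rintegral => x _; congr (_ ^+ 2); ring.
have -> : \int[mu]_x (s x + v x - (s x + s' x)) ^+ 2 = \int[mu]_x (v x - s' x) ^+ 2.
  by apply: eq_Rintegral => x _; congr (_ ^+ 2); ring.
lra.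
Qed.

Lemma step_approximableZ (r : R) u : step_approximable u ->
  step_approximable (fun x => r * u x).
Proof.
move=> [su hu]; split; first exact: (square_integrableM (bounded_mfun_cst r) su).
move=> e e0; have e1 : 0 < e / (r ^+ 2 + 1) by rewrite divr_gt0 // ltr_pwDr // sqr_ge0.
have [n [s [[bs cs] us]]] := hu _ e1; exists n, (fun x => r * s x); split.
  split=> [|k y hy]; last by rewrite cs.
  exact: (bounded_mfunM (bounded_mfun_cst r) bs).
have [_ i] := square_integrableB su (bounded_square_integrable mu bs).
have -> : \int[mu]_x (r * u x - r * s x) ^+ 2 = \int[mu]_x (r ^+ 2 * (u x - s x) ^+ 2).
  by apply: eq_Rintegral => x _; ring.
rewrite RintegralZl //; move: us; rewrite ler_pdivlMr; last by rewrite ltr_pwDr // sqr_ge0.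
have : 0 <= \int[mu]_x (u x - s x) ^+ 2 by apply: Rintegral_ge0 => x _; exact: sqr_ge0.
by nra.
Qed.

Lemma step_approximable_adic n s : adic_step n s -> step_approximable s.
Proof.
move=> hs; split; first by apply: bounded_square_integrable; case: hs.
move=> e e0; exists n, s; split=> //.
under eq_Rintegral do rewrite subrr expr0n /=.
by rewrite probability_Rintegral_cst ltW.
Qed.

Lemma step_approximable_cst (a : R) : step_approximable (fun=> a).
Proof. by apply: (@step_approximable_adic 0); split=> //; exact: bounded_mfun_cst. Qed.

Lemma step_approximable_sum (I : Type) (r : seq I) (F : I -> T -> R) :
  (forall i, step_approximable (F i)) ->
  step_approximable (fun x => \sum_(i <- r) F i x).
Proof.
move=> hF; elim: r => [|i r IH].
  by under eq_fun do rewrite big_nil; exact: step_approximable_cst.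
by under eq_fun do rewrite big_cons; exact: step_approximableD.
Qed.

Let indic (A : set T) (x : T) : R := \1_A x.

Let bounded_indic A : measurable A -> bounded_mfun (indic A).
Proof.
move=> mA; split; first exact: measurable_indic.
by exists 1 => x; rewrite /indic indicE; case: (_ \in _); rewrite ?normr0 ?normr1.
Qed.

Let approximable_set : set (set T) :=
  [set A | measurable A /\ step_approximable (indic A)].

Let sqdist_indic A B : B `<=` A -> measurable A -> measurable B ->
  \int[mu]_x (indic A x - indic B x) ^+ 2 = fine (mu A - mu B)%E.
Proof.
move=> BA mA mB; have mAB : measurable (A `\` B) by exact: measurableD.
have -> : (mu A - mu B)%E = mu (A `\` B).
  rewrite measureD // ?setIidr //.
  by apply: le_lt_trans (ltry 1); exact: probability_le1.
rewrite -[A `\` B]setIT -integral_indic //.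
congr fine; apply: eq_integral => x _; congr EFin.
rewrite /indic !indicE in_setD; case: (boolP (x \in B)) => [/set_mem/BA/mem_set ->|_] /=.
  by rewrite subrr expr0n.
by rewrite andbT subr0; case: (_ \in _); rewrite ?expr1n ?expr0n.
Qed.

Let approximable_ndseq : ndseq_closed approximable_set.
Proof.
move=> F ndF hF; have mF i : measurable (F i) by case: (hF i).
have mU : measurable (\bigcup_i F i) by exact: bigcupT_measurable.
split=> //; apply: step_approximable_limit.
  by apply: bounded_square_integrable; exact: bounded_indic.
move=> e e0; have cv := nondecreasing_cvg_mu mF mU ndF.
have fin A : measurable A -> mu A \is a fin_num by exact: fin_num_measure.
have /cvgrPdist_le/(_ e e0) [n _ /(_ n (leqnn n))] :
    fine \o (mu \o F) @ \oo --> fine (mu (\bigcup_i F i)).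
  by apply: fine_cvg; rewrite fineK; [exact: cv|exact: fin].
move=> /= hn; exists (indic (F n)); split; first by case: (hF n).
rewrite sqdist_indic //; last exact: bigcup_sup.
by rewrite fineB; [exact: le_trans (ler_norm _) hn|exact: fin|exact: fin].
Qed.

Let approximable_lambda : lambda_system setT approximable_set.
Proof.
split=> //.
- split=> //; rewrite /indic indicT; exact: step_approximable_cst.
- move=> A B BA [mA hA] [mB hB]; split; first exact: measurableD.
  have -> : indic (A `\` B) = (fun x => indic A x + -1 * indic B x).
    apply/funext => x; rewrite /indic !indicE in_setD.
    case: (boolP (x \in B)) => [/set_mem/BA/mem_set ->|_] /=; first by rewrite mulr1 subrr.
    by rewrite andbT mulr0 addr0.
  by apply: step_approximableD => //; exact: step_approximableZ.
Qed.

Let approximable_ray (x : R) : approximable_set `]-oo, x[%classic.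
Proof.
(* The largest [b]-adic number of level [n] that is at most [x]. *)
pose c n : R := (Num.floor (b%:R ^+ n * x))%:~R / b%:R ^+ n.
have -> : `]-oo, x[%classic = \bigcup_n `]-oo, c n[%classic :> set T.
  apply/seteqP; split=> y /=; last first.
    move=> [n _] /=; rewrite !in_itv /= => /lt_le_trans; apply.
    by rewrite ler_pdivrMr // mulrC floor_le.
  rewrite in_itv /= => yx; have xy : 0 < x - y by rewrite subr_gt0.
  have := archi_boundP (ltW (divr_gt0 ltr01 xy)); set n := Num.bound _ => hn.
  exists n => //=; rewrite in_itv /= ltr_pdivlMr //.
  have h1 := floorD1_gt (b%:R ^+ n * x); rewrite intrD in h1.
  have h2 : 1 < b%:R ^+ n * (x - y).
    move: hn; rewrite ltr_pdivrMr // => /lt_le_trans; apply.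
    by rewrite ler_pM2r // -natrX ler_nat ltnW // ltn_expl.
  by move: h1 h2; rewrite mulrBr; lra.
apply: approximable_ndseq.
  apply/nondecreasing_seqP => n; apply/subsetPset => y /=; rewrite !in_itv /=.
  move=> /lt_le_trans; apply; rewrite /c exprS.
  set Z := Num.floor _; set Z' := Num.floor _.
  have -> : Z'%:~R / (b%:R * b%:R ^+ n) = Z'%:~R / b%:R / b%:R ^+ n :> R.
    by rewrite invfM mulrA.
  have bZ : (b%:Z)%:~R = b%:R :> R by [].
  rewrite ler_pM2r ?invr_gt0 // ler_pdivlMr //.
  have : Z * b%:Z <= Z'.
    by rewrite floor_ge_int intrM bZ mulrC -mulrA ler_pM2l // floor_le.
  by rewrite -(ler_int R) intrM bZ.
move=> n; split; first exact: measurable_itv.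
apply: (@step_approximable_adic n); split; first by apply: bounded_indic; exact: measurable_itv.
move=> k y /andP[y0 y1]; rewrite /indic !indicE; congr (_%:R); congr nat_of_bool.
have key (z : R) : 0 <= z < 1 -> (zoom b n k z \in `]-oo, c n[%classic) =
    (k%:Z < Num.floor (b%:R ^+ n * x)).
  move=> /andP[z0 z1]; apply/idP/idP; rewrite inE /= in_itv /= /zoom ltr_pM2r ?invr_gt0 //.
    by move=> h; rewrite -(ltr_int R); apply: le_lt_trans h; rewrite lerDl.
  rewrite -lezD1 -(ler_int R) intrD; apply: lt_le_trans.
  by rewrite ltrD2l.
by rewrite !key ?lexx ?ltr01 // y0.
Qed.

(** Dynkin's argument: half-lines generate the Borel sets and are increasing
    unions of half-lines with [b]-adic endpoints, whose indicators are steps. *)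
Lemma step_approximable_indic A : measurable A -> step_approximable (indic A).
Proof.
move=> mA; suff [] : approximable_set A by [].
move: mA; rewrite [measurable](RGenInftyO.measurableE R).
apply: (lambda_system_subset _ approximable_lambda).
- move=> _ _ [x ->] [y ->]; exists (Num.min x y).
  apply/seteqP; split=> z /=; rewrite !in_itv /= lt_min.
    by move=> [-> ->].
  by move=> /andP[].
- by move=> _ [x ->]; exact: approximable_ray.
- by [].
Qed.

End StepDensity.

Section StepDensityL2.
Context {R : realType}.
Variables (b : nat) (mu : probability (measurableTypeR R) R).
Hypothesis b_gt1 : (1 < b)%N.
Local Notation T := (measurableTypeR R).
Implicit Types (u v s : T -> R).
Local Notation sqint := (square_integrable mu).

Import HBNNSimple.

Lemma step_approximable_nnsfun (u : {nnsfun T >-> R}) : step_approximable b mu u.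
Proof.
rewrite (funext (fimfunEord u)); set sq := finmap.enum_fset _.
have h (y : R) : step_approximable b mu (fun x => y * \1_(u @^-1` [set y]) x).
  by apply: step_approximableZ; exact: (step_approximable_indic mu b_gt1).
exact: (step_approximable_sum b_gt1 (index_enum _) (fun i : 'I_(size sq) => h (nth 0 sq i))).
Qed.

(** Increasing simple functions converge in mean square by domination. *)
Lemma step_approximable_ge0 u : sqint u -> (forall x, 0 <= u x) ->
  step_approximable b mu u.
Proof.
move=> su u0; have [mu_ iu] := su.
have muE : measurable_fun setT (EFin \o u) by exact/measurable_EFinP.
have u0E (x : T) : setT x -> (0 <= (EFin \o u) x)%E by move=> _; rewrite lee_fin.
pose v k : {nnsfun T >-> R} := nnsfun_approx measurableT muE k.
have cv x : (fun k => v k x) @ \oo --> u x.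
  by case/fine_cvgP: (@cvg_nnsfun_approx _ _ _ _ measurableT _ muE u0E x I).
have v_le k x : v k x <= u x.
  by rewrite -lee_fin /v nnsfun_approxE; exact: (le_approx k u0E).
have v_ge0 k x : 0 <= v k x by [].
apply: (step_approximable_limit su) => e e0.
have mF k : measurable_fun setT (EFin \o (fun x => (u x - v k x) ^+ 2)).
  by apply/measurable_EFinP; apply: measurable_funX; exact: measurable_funB.
have cF (x : T) : (fun k => ((u x - v k x) ^+ 2)%:E) @ \oo --> (0 : \bar R)%E.
  have c1 : (fun k => u x - v k x) @ \oo --> (u x - u x).
    by apply: cvgB; [exact: cvg_cst|exact: cv].
  have := cvgM c1 c1; rewrite subrr mulr0 => c2.
  by apply/fine_cvgP; split; [exact: nearW|exact: c2].
have bF k (x : T) : (`|((u x - v k x) ^+ 2)%:E| <= (u x ^+ 2)%:E)%E.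
  rewrite lee_fin ger0_norm ?sqr_ge0 //.
  by rewrite lerXn2r ?nnegrE ?subr_ge0 // gerBl.
have [] := @dominated_convergence _ _ _ mu setT measurableT
  (fun k => EFin \o (fun x => (u x - v k x) ^+ 2)) (cst 0%E)
  (EFin \o (fun x => u x ^+ 2)) mF (measurable_cst _) _ iu _.
- by apply: aeW => x _; exact: cF.
- by apply: aeW => x k _; exact: bF.
move=> _ _; rewrite integral0 => /fine_cvgP[_].
move=> /cvgrPdist_le/(_ e e0) [n _ /(_ n (leqnn n))] /= hn.
exists (v n); split; first exact: step_approximable_nnsfun.
by apply: le_trans (ler_norm _) _; rewrite -normrN -sub0r.
Qed.

Lemma step_approximable_square_integrable u : sqint u -> step_approximable b mu u.
Proof.
move=> su; have mu_ := su.1.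
have part (p : T -> R) : measurable_fun setT p ->
    (forall x, 0 <= p x) -> (forall x, p x <= `|u x|) -> step_approximable b mu p.
  move=> mp p0 pu; apply: step_approximable_ge0 => //; split=> //.
  apply: (@le_integrable _ _ _ _ _ measurableT _ (EFin \o (fun x => u x ^+ 2))).
  - by apply/measurable_EFinP; exact: measurable_funX.
  - move=> x _ /=; rewrite lee_fin !ger0_norm ?sqr_ge0 //.
    by rewrite -[leRHS]real_normK ?num_real // lerXn2r ?nnegrE.
  - by case: su.
have -> : u = (fun x => Num.max (u x) 0 + -1 * Num.max (- u x) 0).
  apply/funext => x; rewrite mulN1r; case: (leP 0 (u x)) => h.
    by rewrite max_r ?subr0 // oppr_le0.
  by rewrite max_l ?sub0r ?opprK // oppr_ge0 ltW.
apply: (step_approximableD b_gt1); last apply: step_approximableZ.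
- apply: part => [|x|x]; first exact: measurable_maxr.
    by rewrite le_max lexx orbT.
  by rewrite ge_max ler_norm normr_ge0.
- apply: part => [|x|x]; first by apply: measurable_maxr => //; exact: measurable_funN.
    by rewrite le_max lexx orbT.
  by rewrite ge_max normr_ge0 -normrN ler_norm.
Qed.

Lemma level_step_dense (f : T -> R[i]) (e : R) : csquare_integrable mu f -> 0 < e ->
  exists n (s : T -> R[i]), level_step b n s /\ sqnorm mu (fun x => f x - s x) <= e.
Proof.
move=> [fr fi] e0; have e2 : 0 < e / 2 by lra.
have [_ /(_ _ e2) [n [s [hs sr]]]] := step_approximable_square_integrable fr.
have [_ /(_ _ e2) [n' [s' [hs' si]]]] := step_approximable_square_integrable fi.
have bs := hs.1; have bs' := hs'.1; have b0 := ltnW b_gt1.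
have cs := adic_constant_le b0 (leq_maxl n n') hs.2.
have cs' := adic_constant_le b0 (leq_maxr n n') hs'.2.
exists (maxn n n'), (fun x => Complex (s x) (s' x)); split.
  by split=> [|k y hy]; [split|rewrite cs // cs'].
have ss := bounded_square_integrable mu bs; have ss' := bounded_square_integrable mu bs'.
rewrite /sqnorm (_ : \int[mu]_x _ = \int[mu]_x
    ((Re (f x) - s x) ^+ 2 + (Im (f x) - s' x) ^+ 2)); last first.
  by apply: eq_Rintegral => x _; rewrite /sqnormc; case: (f x).
rewrite RintegralD //; first by lra.
- by case: (square_integrableB fr ss).
- by case: (square_integrableB fi ss').
Qed.

End StepDensityL2.

(** * The norm of square-integrable functions *)

Section L2Norm.
Context {R : realType}.
Variable mu : probability (measurableTypeR R) R.
Local Notation T := (measurableTypeR R).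
Implicit Types (f : T -> R[i]).

Lemma L2norm_poweR f :
  (L2norm mu f `^ 2 = \int[mu]_x (sqnormc (f x))%:E)%E.
Proof.
rewrite /L2norm poweR_Lnorm //; apply: eq_integral => x _.
have n0 : 0 <= Normc.normc (f x) by case: (f x) => u v; exact: sqrtr_ge0.
by rewrite gee0_abs ?lee_fin // poweR_EFin powR_mulrn // sqr_normc_sqnormc.
Qed.

Lemma L2_square_integrable f : L2 mu f -> csquare_integrable mu f.
Proof.
move=> [[mr mi] fin].
have : (\int[mu]_x (sqnormc (f x))%:E < +oo)%E by rewrite -L2norm_poweR poweR_lty.
have msq : measurable_fun setT (fun x : T => sqnormc (f x)).
  by apply: measurable_funD; exact: measurable_funX.
move=> ifin; have isq : mu.-integrable setT (EFin \o (fun x => sqnormc (f x))).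
  apply/integrableP; split; first exact/measurable_EFinP.
  rewrite (eq_integral (fun x => (sqnormc (f x))%:E)) // => x _.
  by rewrite gee0_abs // lee_fin sqnormc_ge0.
have part (u : T -> R) : measurable_fun setT u ->
    (forall x, u x ^+ 2 <= sqnormc (f x)) -> square_integrable mu u.
  move=> mu_ uf; split=> //.
  apply: (@le_integrable _ _ _ _ _ measurableT _ (EFin \o (fun x => sqnormc (f x)))) => //.
    by apply/measurable_EFinP; exact: measurable_funX.
  by move=> x _ /=; rewrite lee_fin !ger0_norm ?sqr_ge0 ?sqnormc_ge0.
by split; apply: part => // x; rewrite ?lerDl ?lerDr sqr_ge0.
Qed.

Lemma L2norm_lt f (e : R) : csquare_integrable mu f -> 0 < e ->
  sqnorm mu f < e ^+ 2 -> (L2norm mu f < e%:E)%E.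
Proof.
move=> sf e0 fe; rewrite ltNge; apply/negP => eL.
have : (e%:E `^ 2 <= L2norm mu f `^ 2)%E.
  apply: gt0_ler_poweR => //.
    by rewrite in_itv /= leey andbT lee_fin ltW.
  by rewrite in_itv /= leey andbT; exact: Lnorm_ge0.
rewrite L2norm_poweR poweR_EFin powR_mulrn; last exact: ltW.
have fin : (\int[mu]_x (sqnormc (f x))%:E)%E \is a fin_num.
  by apply: integrable_fin_num => //; exact: sqnormc_integrable.
by rewrite -(fineK fin) lee_fin leNgt fe.
Qed.

End L2Norm.

(** * Counting sparse frequencies *)

Section Counting.
Context {R : realType}.

Lemma counting_le_size (A : set R) (s : seq R) :
  A `<=` [set` s] -> (counting A <= (size s)%:R%:E :> \bar R)%E.
Proof.
move=> As; have fA : finite_set A by exact: sub_finite_set As (finite_seq s).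
rewrite /counting asboolT // lee_fin ler_nat.
apply: uniq_leq_size; first exact: finmap.fset_uniq.
by move=> x; rewrite in_fset_set // => /set_mem/As.
Qed.

End Counting.

Section Sparse.
Context {R : realType}.
Variables (q m : nat) (N : nat -> nat) (g : R -> R).
Hypotheses (q_gt0 : (0 < q)%N) (m_gt1 : (1 < m)%N) (b_gt2 : (2 < q * m)%N).
Hypothesis N_large : forall a n, (a < q ^ n)%N -> (a < q ^ N a)%N.
Hypothesis N_mono : {homo N : a b / (a < b)%N}.
Hypothesis g_large : forall a x, (N a)%:R <= x -> a.+1%:R ^+ 2 <= g x.
Local Notation b := (q * m)%N.
Local Notation lam a := ((freq q m N a)%:R : R).

(** The bound [a < q ^ n] restricts the index only for [q = 1], where [mu] is a
    Dirac mass and its spectrum is a single frequency. *)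
Definition sparse_frequencies : set R :=
  [set lam a | a in [set a | exists n, (a < q ^ n)%N]].
Local Notation Lambda := sparse_frequencies.

Let exp_ge4 n : (4 * n <= b ^ n.+1)%N.
Proof.
elim: n => // n IH; rewrite expnS; move: IH b_gt2; move: (b) => c.
have [->|n0] := posnP n; first by rewrite expn1; nia.
by move: (c ^ n.+1)%N => w; nia.
Qed.

(** Since frequencies double, two of them within distance [2 * r] force the larger
    one below [4 * r], hence [N a' <= r]. *)
Lemma close_frequencies a a' x r n : (a < a')%N -> (a' < q ^ n)%N ->
  `|lam a - x| < r -> `|lam a' - x| < r -> a'.+1%:R ^+ 2 <= g r.
Proof.
move=> aa' an' ax a'x.
have [gap big] := freq_gap q_gt0 b_gt2 N_large N_mono aa' an'.
apply: g_large.
have h1 : 2 * lam a <= lam a' by rewrite -(natrM _ 2) ler_nat.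
have h2 : 4 * (N a')%:R <= lam a'.
  by rewrite -(natrM _ 4) ler_nat (leq_trans (exp_ge4 _)).
by move: ax a'x; rewrite !ltr_norml => /andP[? ?] /andP[? ?]; lra.
Qed.

(** Either a window contains at most one frequency, or every index [a] occurring
    in it satisfies [a.+1 ^ 2 <= g r], so at most [sqrt (g r)] indices occur. *)
Lemma max_count_le r : 1 <= g r -> (max_count Lambda r <= (Num.sqrt (g r))%:E)%E.
Proof.
move=> gr1; apply: ub_ereal_sup => _ [x _ <-].
have sq1 : 1 <= Num.sqrt (g r) by rewrite -[X in X <= _]sqrtr1 ler_sqrt // (le_trans ler01).
have near_x y : (`]x - r, x + r[%classic : set R) y -> `|y - x| < r.
  by rewrite /= in_itv /= ltr_norml => /andP[? ?]; apply/andP; split; lra.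
have [[a [a' [n [aa' an' ax a'x]]]]|lonely] := pselect (exists a a' n,
    [/\ (a < a')%N, (a' < q ^ n)%N, `|lam a - x| < r & `|lam a' - x| < r]).
  pose A := Num.truncn (Num.sqrt (g r)).
  have small c n' : (c < q ^ n')%N -> `|lam c - x| < r -> (c < A)%N.
    move=> cn cx; suff c2 : c.+1%:R ^+ 2 <= g r.
      rewrite truncn_gt_nat -[leLHS]ger0_norm ?ler0n // -sqrtr_sqr ler_sqrt //.
      exact: le_trans (sqr_ge0 _) c2.
    have [ca|ac] := ltnP c a'.
      apply: le_trans (close_frequencies aa' an' ax a'x).
      by rewrite lerXn2r ?nnegrE ?ler0n // ler_nat ltnS ltnW.
    exact: (close_frequencies (leq_trans aa' ac) cn ax cx).
  apply: (@le_trans _ _ (size [seq lam c | c <- iota 0 A])%:R%:E).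
    apply: counting_le_size => _ [[c [n' cn] <-] /near_x cx] /=.
    by apply/mapP; exists c => //; rewrite mem_iota add0n (small _ _ cn cx).
  by rewrite size_map size_iota lee_fin truncn_le ?sqrtr_ge0.
have [[c [[n cn] cx]]|none] := pselect (exists c, (exists n, (c < q ^ n)%N) /\ `|lam c - x| < r).
  apply: (@le_trans _ _ (size [:: lam c])%:R%:E); last by rewrite lee_fin.
  apply: counting_le_size => _ [[c' [n' cn'] <-] /near_x cx'] /=; rewrite inE.
  apply/eqP; congr (_%:R); congr freq; case: (ltngtP c' c) => // h; exfalso; apply: lonely.
    by exists c', c, n.
  by exists c, c', n'.
apply: (@le_trans _ _ (size ([::] : seq R))%:R%:E); last by rewrite lee_fin sqrtr_ge0.
apply: counting_le_size => _ [[c' [n' cn'] <-] /near_x cx'] /=.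
by exfalso; apply: none; exists c'; split=> //; exists n'.
Qed.

Lemma max_count_ge0 (A : set R) r : (0 <= max_count A r)%E.
Proof.
apply: (@le_trans _ _ (counting (A `&` `]0 - r, 0 + r[))).
  by rewrite /counting; case: ifP => _; rewrite ?leey // lee_fin ler0n.
by apply: ereal_sup_ubound; exists 0.
Qed.

Lemma max_count_ratio : g x @[x --> +oo] --> +oo ->
  (max_count Lambda r / (g r)%:E)%E @[r --> +oo] --> (0 : \bar R)%E.
Proof.
move=> g_infty.
have lim0 : (Num.sqrt (g r))^-1 @[r --> +oo] --> (0 : R).
  apply/cvgrPdist_lt => e e0.
  near=> r; have gr : (e^-1 + 1) ^+ 2 <= g r by near: r; exact: cvgry_ge.
  have e1 : 0 < e^-1 by rewrite invr_gt0.
  have sq : e^-1 + 1 <= Num.sqrt (g r).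
    rewrite -[leLHS]ger0_norm; last by lra.
    by rewrite -sqrtr_sqr ler_sqrt // (le_trans (sqr_ge0 _) gr).
  have s0 : 0 < Num.sqrt (g r) by lra.
  rewrite sub0r normrN gtr0_norm ?invr_gt0 //.
  by rewrite -[ltRHS]invrK ltf_pV2 ?posrE //; lra.
apply: (@squeeze_cvge _ _ _ _ (fun=> 0%E) _ (fun r => ((Num.sqrt (g r))^-1)%:E)).
- near=> r; have gr : 1 <= g r by near: r; exact: cvgry_ge.
  have g0 : 0 < g r by lra.
  have s0 : 0 < Num.sqrt (g r) by rewrite sqrtr_gt0.
  rewrite inver gt_eqF //; apply/andP; split.
    by rewrite mule_ge0 ?max_count_ge0 // lee_fin invr_ge0 ltW.
  apply: (@le_trans _ _ ((Num.sqrt (g r))%:E * ((g r)^-1)%:E)%E).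
    by rewrite lee_wpmul2r ?max_count_le // lee_fin invr_ge0 ltW.
  have -> : (g r)^-1 = (Num.sqrt (g r))^-1 * (Num.sqrt (g r))^-1.
    by rewrite -invfM -expr2 sqr_sqrtr // ltW.
  by rewrite -EFinM lee_fin mulrA mulfV ?gt_eqF // mul1r.
- exact: cvg_cst.
- by apply/fine_cvgP; split; [exact: nearW|exact: lim0].
Unshelve. all: by end_near.
Qed.

End Sparse.

Section GapFunction.
Context {R : realType}.

(** Summing thresholds beyond which [g] is at least [a.+1 ^ 2] gives an increasing [N].
    For [q = 1] the only index below a power of [q] is [0]. *)
Lemma rapid_gaps (q : nat) (g : R -> R) : (0 < q)%N -> g x @[x --> +oo] --> +oo ->
  exists N : nat -> nat, [/\ forall a n, (a < q ^ n)%N -> (a < q ^ N a)%N,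
    {homo N : a b / (a < b)%N} &
    forall a x, (N a)%:R <= x -> a.+1%:R ^+ 2 <= g x].
Proof.
move=> q0 g_infty.
have [G hG] : {G : nat -> nat & forall a x, (G a)%:R <= x -> a.+1%:R ^+ 2 <= g x}.
  apply: (@choice _ _ (fun a G => forall x, G%:R <= x -> a.+1%:R ^+ 2 <= g x)) => a.
  have [M [_ hM]] := cvgry_ge g_infty (a.+1%:R ^+ 2).
  exists (Num.truncn M).+1 => x hx; apply: hM; apply: lt_le_trans hx.
  exact: truncnS_gt.
exists (fun a => \sum_(i < a.+1) (G i).+1)%N; split.
- move=> a n; have [->|q1] := eqVneq q 1%N; first by rewrite !exp1n.
  move=> _; have {}q1 : (1 < q)%N by rewrite ltn_neqAle eq_sym q1.
  apply: leq_trans (ltn_expl a q1) _; rewrite leq_pexp2l //.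
  apply: (@leq_trans (\sum_(i < a.+1) 1)); first by rewrite sum1_card card_ord.
  exact: leq_sum.
- move=> a c ac; rewrite -!(big_mkord xpredT (fun i => (G i).+1)).
  rewrite (@big_cat_nat _ _ _ a.+1 0 c.+1) //=; last exact: leqW.
  by rewrite -addn1 leq_add2l (big_ltn (ac : (a.+1 < c.+1)%N)).
- move=> a x hx; apply: hG; apply: le_trans hx; rewrite ler_nat big_ord_recr /=.
  by rewrite (leq_trans (leqnSn _)) // leq_addl.
Qed.

End GapFunction.

(** * Completeness of the sparse exponentials *)

Section Completeness.
Context {R : realType}.
Variables (q m : nat) (N : nat -> nat) (mu : probability (measurableTypeR R) R).
Hypotheses (q_gt0 : (0 < q)%N) (m_gt1 : (1 < m)%N) (b_gt2 : (2 < q * m)%N).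
Hypothesis N_large : forall a n, (a < q ^ n)%N -> (a < q ^ N a)%N.
Hypothesis hmu : self_similar q (q * m) mu.
Local Notation b := (q * m)%N.
Local Notation lam a := ((freq q m N a)%:R : R).
Local Notation inner := (L2inner mu).

Let e (a : nat) := @cexpo R (lam a).
Let e_sq a : csquare_integrable mu (e a).
Proof. by apply: cbounded_square_integrable; exact: cbounded_cexpo. Qed.

Let k0 : R := fourier_bound b ^+ 4.
Let k0_gt0 : 0 < k0. Proof. by rewrite exprn_gt0 // fourier_bound_gt0. Qed.
Let k0_le1 : k0 <= 1.
Proof. by apply: exprn_ile1; rewrite ?fourier_bound_le1 // ltW // fourier_bound_gt0. Qed.

(** The approximation error [k0 / 16] is chosen so that the loss in
    [frame_bound_nearby] leaves half of the constant [k0 / 4]. *)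
Lemma exponential_frame u : csquare_integrable mu u -> 0 < sqnorm mu u ->
  exists n, forall n', (n <= n')%N ->
    k0 / 8 * sqnorm mu u <= \sum_(a < q ^ n') sqnormc (inner u (e a)).
Proof.
move=> su u0.
have k00 : 0 < k0 by exact: k0_gt0.
have d0 : 0 < k0 / 16 * sqnorm mu u by rewrite mulr_gt0 // divr_gt0.
have [n [s [hs us]]] := level_step_dense (ltnW b_gt2) su d0.
exists n => n' nn'.
have hs' : level_step b n' s.
  by split; [exact: hs.1|exact: (adic_constant_le (ltnW (ltnW b_gt2)) nn' hs.2)].
have frame := level_step_frame q_gt0 m_gt1 b_gt2 N_large hmu hs'.
have orth a a' := @cexpo_freq_orthonormal _ _ _ _ _ q_gt0 m_gt1 N_large hmu n' a a'.
have k01 : 0 <= k0 <= 1 by rewrite (ltW k0_gt0) k0_le1.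
have ss := cbounded_square_integrable mu hs'.1.
by have := frame_bound_nearby e_sq orth k01 su ss frame; lra.
Qed.

Lemma sparse_spectrum : spectrum mu (sparse_frequencies q m N).
Proof.
split.
- by apply: sub_countable (card_image_le _ _) (countableP _).
- move=> _ _ [a [n an] <-] [a' [n' an'] <-].
  have le_max c k : (c < q ^ k)%N -> (k <= maxn n n')%N -> (c < q ^ maxn n n')%N.
    by move=> ck kn; apply: leq_trans ck _; rewrite leq_pexp2l.
  have an2 := le_max _ _ an (leq_maxl _ _); have an2' := le_max _ _ an' (leq_maxr _ _).
  have orth := cexpo_freq_orthonormal q_gt0 m_gt1 N_large hmu an2 an2'.
  rewrite orth; congr (_%:R); congr nat_of_bool; apply/idP/idP; first by move/eqP ->.
  (* Distinct indices give distinct frequencies, as otherwise two orthogonal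
     exponentials would coincide. *)
  move/eqP => ee; move: orth; rewrite ee inner_cexpo subrr fourier0.
  by case: (a == a') => // /eqP; rewrite oner_eq0.
- move=> f /L2_square_integrable sf eps eps0.
  have k8 : 0 < k0 / 8 <= 1 by have := k0_gt0; have := k0_le1; lra.
  have Kmono : {homo (fun n => q ^ n)%N : n n' / (n <= n')%N}.
    by move=> n n' nn'; rewrite leq_pexp2l.
  have [n hn] := frame_residual_small e_sq Kmono
    (fun n a a' => @cexpo_freq_orthonormal _ _ _ _ _ q_gt0 m_gt1 N_large hmu n a a')
    k8 exponential_frame sf (exprn_gt0 2 eps0).
  exists [seq lam a | a <- iota 0 (q ^ n)], (fun l => inner f (cexpo l)); split.
    move=> _ /mapP[a an ->]; exists a => //; exists n.
    by move: an; rewrite mem_iota add0n.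
  have -> : (fun x => f x - \sum_(l <- [seq lam a | a <- iota 0 (q ^ n)])
      inner f (cexpo l) * cexpo l x) = residual mu e (q ^ n) f.
    apply/funext => x; rewrite /residual big_map; congr (_ - _).
    by rewrite -(big_mkord xpredT (fun a => inner f (e a) * e a x)) /index_iota subn0.
  by apply: L2norm_lt => //; exact: residual_square_integrable.
Qed.

End Completeness.

(** * Existence of arbitrarily sparse spectra *)

Theorem theorem2p9 (R : realType) (q b : nat)
    (hb : (2 < b)%N) (hq : (0 < q)%N) (hqb : (q < b)%N) (hgcd : gcdn q b = q)
    (mu : probability (measurableTypeR R) R) (hmu : self_similar q b mu)
    (g : R -> R)
    (g_ge0 : forall x : R, 0 <= x -> 0 <= g x)
    (g_incr : forall x y : R, 0 <= x -> x <= y -> g x <= g y)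
    (g_infty : g x @[x --> +oo] --> +oo) :
  exists Lambda : set R,
    spectrum mu Lambda /\
    (max_count Lambda r / (g r)%:E)%E @[r --> +oo] --> (0 : \bar R)%E.
Proof.
have [m bE] : exists m, b = (q * m)%N.
  by exists (b %/ q)%N; rewrite mulnC divnK // -hgcd dvdn_gcdr.
subst b; have m_gt1 : (1 < m)%N by rewrite -(ltn_pmul2l hq) muln1.
have [N [N_large N_mono g_large]] := rapid_gaps hq g_infty.
exists (sparse_frequencies q m N); split; first exact: sparse_spectrum.
exact: (max_count_ratio hq m_gt1 hb N_large N_mono g_large g_infty).
Qed.
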